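(* Let $\mathrm{AC}(\tau)$ denote the long-run average cost of the clearing cycle $\tau$. The optimal quantity policy is the quantity policy $\tau=T_Q$ whose parameter $Q>0$ minimizes $\mathrm{AC}(T_Q)$ over all $Q>0$. The optimal time policy is the time policy $\tau=T$ (deterministic) whose parameter $T>0$ minimizes $\mathrm{AC}(T)$ over all $T>0$. (a) If $\sum_{i=1}^{n}\omega_i(2D\sigma_i^2-D_i\sigma^2)>0$, then the optimal quantity policy achieves less average cost than the optimal time policy, i.e. $\min_{Q>0}\mathrm{AC}(T_Q)<\min_{T>0}\mathrm{AC}(T)$. (b) If $\sum_{i=1}^{n}\omega_i(2D\sigma_i^2-D_i\sigma^2)<0$, then the optimal time policy achieves less average cost than the optimal quantity policy, i.e. $\min_{T>0}\mathrm{AC}(T)<\min_{Q>0}\mathrm{AC}(T_Q)$.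
   Context: Let $n\ge 1$, let $B_1,\dots,B_n$ be independent standard Brownian motions (started at $0$), and let $N_i(t)=D_it+\sigma_iB_i(t)$ with $D_i>0$, $\sigma_i>0$ for $i=1,\dots,n$ (cumulative demand of items of type $i$). Put $D=\sum_{i=1}^nD_i$ and $\sigma^2=\sum_{i=1}^n\sigma_i^2$. The cost parameters are: $A_D>0$ (fixed cost of a clearing), $c_i\in\mathbb{R}$ (unit transport cost for type $i$), $\omega_i>0$ (waiting cost per unit of type $i$ per unit time). For a stopping time $\tau$ (the clearing cycle of a renewal-type clearing policy) of the natural filtration of $(N_1,\dots,N_n)$ with $0<\mathbb{E}[\tau]<\infty$, the long-run average cost is $$\mathrm{AC}(\tau)=\frac{A_D+\mathbb{E}\left[\sum_{i=1}^nc_iN_i(\tau)\right]+\mathbb{E}\left[\sum_{i=1}^n\int_0^\tau\omega_iN_i(u)\,du\right]}{\mathbb{E}[\tau]}.$$ The quantity policy with parameter $Q>0$ has clearing cycle $\tau=T_Q=\inf\{t>0:\sum_{i=1}^nN_i(t)\ge Q\}$; the time policy with parameter $T>0$ has the deterministic clearing cycle $\tau=T$. *)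

(* Defs.v *)
From HB Require Import structures.
From mathcomp Require Import all_boot all_order all_algebra.
From mathcomp Require Import all_classical all_reals all_analysis.

Set Implicit Arguments.
Unset Strict Implicit.
Unset Printing Implicit Defensive.

Import Order.TTheory GRing.Theory Num.Theory.
Import numFieldNormedType.Exports.

Local Open Scope classical_set_scope.
Local Open Scope ring_scope.

Section probabilistic_notions.
Context {d : measure_display} {T : measurableType d} {R : realType}.

Definition sigma_process (J : set R) (X : R -> T -> R) : set (set T) :=
  <<s \bigcup_(t in J) preimage_set_system setT (X t) measurable >>.

Definition mutually_independent (P : probability T R) (I : finType)
    (F : I -> set (set T)) : Prop :=
  forall (J : {set I}) (A : I -> set T),
    (forall i, i \in J -> F i (A i)) ->
    P (\bigcap_(i in [set` J]) A i) = (\prod_(i in J) P (A i))%E.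

(* Processes are indexed by R; only the times t >= 0 are constrained or used.
   The second parameter of normal_prob is the standard deviation. *)
Record standard_brownian_motion (P : probability T R)
    (B : R -> {RV P >-> R}) : Prop := StandardBrownianMotion {
  bm_start : forall w, B 0 w = 0 ;
  bm_continuous : forall w,
    {within `[0, +oo[, continuous (fun t : R => B t w)} ;
  bm_normal_increments : forall s t : R, 0 <= s -> s < t ->
    forall C : set R, measurable C ->
      P ((B t \- B s) @^-1` C) = normal_prob 0 (Num.sqrt (t - s)) C ;
  bm_independent_increments : forall s t : R, 0 <= s -> s < t ->
    forall (A : set T) (C : set R),
      sigma_process `[0, s] (fun u => B u) A -> measurable C ->
      P (A `&` (B t \- B s)%R @^-1` C) = (P A * P ((B t \- B s)%R @^-1` C))%E }.

Definition independent_processes (P : probability T R) (I : finType)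
    (B : I -> R -> {RV P >-> R}) : Prop :=
  mutually_independent P (fun i => sigma_process `[0, +oo[ (fun t => B i t)).

End probabilistic_notions.

Section clearing_policies.
Context {d : measure_display} {T : measurableType d} {R : realType} {n : nat}.

Definition demand (P : probability T R) (Dm sg : 'I_n -> R)
    (B : 'I_n -> R -> {RV P >-> R}) (i : 'I_n) (t : R) (w : T) : R :=
  Dm i * t + sg i * B i t w.

(* +oo on the paths that never reach the level Q. *)
Definition quantity_time (N : 'I_n -> R -> T -> R) (Q : R) (w : T) : \bar R :=
  ereal_inf [set t%:E | t in [set t : R | 0 < t /\ Q <= \sum_(i < n) N i t w]].

Definition time_cycle (t : R) (w : T) : \bar R := t%:E.

(* Meant for clearing cycles tau with 0 < E[tau] < +oo: such a tau is almost
   surely finite, and the value 0 that fine gives to it on the null event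
   tau = +oo is irrelevant. The waiting cost is a real-valued Lebesgue integral
   along each path. *)
Definition average_cost (P : probability T R) (N : 'I_n -> R -> T -> R)
    (AD : R) (c omega : 'I_n -> R) (tau : T -> \bar R) : \bar R :=
  ((AD%:E
    + 'E_P[fun w => (\sum_(i < n) c i * N i (fine (tau w)) w)%R]
    + 'E_P[fun w => (\sum_(i < n)
         \int[lebesgue_measure]_(u in `[0%R, fine (tau w)])
           (omega i * N i u w))%R])
   / \int[P]_w tau w)%E.

Definition optimal_parameter (f : R -> \bar R) (x : R) : Prop :=
  0 < x /\ forall y, 0 < y -> (f x <= f y)%E.

End clearing_policies.

(* Main.v *)
Require Import Defs.
From HB Require Import structures.
From mathcomp Require Import all_boot all_order all_algebra.
From mathcomp Require Import all_classical all_reals all_analysis.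
From mathcomp Require Import measurable_realfun.
From mathcomp Require Import ring lra.

Set Implicit Arguments.
Unset Strict Implicit.
Unset Printing Implicit Defensive.

Import Order.TTheory GRing.Theory Num.Theory.
Import numFieldNormedType.Exports.

Local Open Scope classical_set_scope.
Local Open Scope ring_scope.

(** Write [W = \sum_i omega_i D_i] and [S] for the sum in the theorem. With
    [f t = A_D / t + W t / 2 + \sum_i c_i D_i] one has [AC(t) = f t], and
    [AC(T_Q) = f (Q / D) - S / (2 D^2)]; since [Q |-> Q / D] is onto the
    positive reals, both policies are optimal at the minimizer
    [t0 = sqrt (2 A_D / W)] of [f] and the gap between the minima is
    [S / (2 D^2)].

    The formula for [tau = T_Q] rests on optional stopping: [E B_i(tau) = 0] and
    [E (B_i(tau) B_j(tau)) = (i == j) E tau]. Multiplying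
    [D tau + \sum_j sigma_j B_j(tau) = Q] by [1], [B_i(tau)] and [tau] and taking
    means gives [E tau = Q / D], [E (tau B_i(tau)) = - sigma_i Q / D^2] and
    [E tau^2], while Fubini and [E (B_i(u); u < tau) = E (B_i(tau); u < tau)]
    give [E \int_0^tau B_i = E (tau B_i(tau))].

    Optional stopping is proved in mean square: the sums of increments over
    dyadic grids up to [tau] satisfy a discrete Ito isometry, hence form a Cauchy
    sequence, and Fatou's lemma identifies their limit with [B_i(tau)]. This is
    done for bounded stopping times first; in general one truncates [tau] at
    level [K] and lets [K] grow. *)

(** * Moments of the normal distribution *)

(** The gap [S / (2 D^2)] weighs two effects of a random cycle [T_Q]. Its variance Q sigma^2 / D^3
    raises the waiting cost; its negative covariance - sigma_i Q / D^2 with [B_i(T_Q)] lowers it,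
    because a clearing comes early exactly when demand has been high.

    Two obstacles shape the proof. First, the mean of [T_Q] is not known to be finite in advance.
    The bounded case is applied to [T_Q] truncated at [K], where total demand is still at most [Q],
    and bounds the truncated mean by Q / D. Only then does the general case apply; it makes the
    [B_i(T_Q)] square-integrable, and the level identity passes this on to [T_Q] itself, as the area
    formula requires.

    Second, optional stopping is stated from a time [u] on an event [A] of the past of [u] that lies
    in {u < tau}. This generality serves to estimate what happens after a truncation level, and to
    compare [B_i(u)] with [B_i(tau)] on {u < tau} and on the parts of it where [B_i(u)] has a given
    sign, which yields the absolute bound behind Fubini. *)

Section normal_moments.
Context {R : realType}.
Local Notation mu := (@lebesgue_measure R).
Implicit Types (m s l : R).

(** The Radon-Nikodym derivative of the normal law and [normal_pdf] have the same integral over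
    every measurable set, so they agree almost everywhere and can be exchanged in the change of
    variables formula. *)
Lemma ge0_integral_normal_prob m s (f : R -> \bar R) :
  measurable_fun [set: R] f -> (forall x, (0 <= f x)%E) ->
  (\int[normal_prob m s]_x f x = \int[mu]_x (f x * (normal_pdf m s x)%:E))%E.
Proof.
move=> mf f0.
pose nu : {finite_measure set _ -> \bar R} := normal_prob m s.
have numu : nu `<< mu by exact: normal_prob_dominates.
rewrite -(Radon_Nikodym_SigmaFinite.change_of_variables numu)//.
have mpdf : measurable_fun [set: R] (fun x => (normal_pdf m s x)%:E).
  by apply/measurable_EFinP; exact: measurable_normal_pdf.
have iD := Radon_Nikodym_SigmaFinite.f_integrable numu.
apply: ae_eq_integral => //.
- by apply: emeasurable_funM => //; exact: measurable_int iD.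
- exact: emeasurable_funM.
- apply: ae_eqe_mul2l => /=; apply: integral_ae_eq => //= E _ mE.
  by rewrite -Radon_Nikodym_SigmaFinite.f_integral.
Qed.

(** Completing the square: the exponential times the centred density is a constant times the density
    with mean l s^2, which has total mass 1. *)
Lemma normal_probV_expR s l : s != 0 ->
  (\int[normal_prob 0 s]_x (expR (l * x))%:E = (expR (l ^+ 2 * s ^+ 2 / 2))%:E)%E.
Proof.
move=> s0; rewrite ge0_integral_normal_prob//; last first.
  by apply/measurable_EFinP; apply: measurableT_comp => //; exact: measurable_funM.
transitivity (\int[mu]_x ((expR (l ^+ 2 * s ^+ 2 / 2))%:E *
    (normal_pdf (l * s ^+ 2) s x)%:E))%E.
  apply: eq_integral => x _; rewrite -!EFinM; congr EFin.
  rewrite !normal_pdfE// mulrCA [in RHS]mulrCA; congr (_ * _).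
  rewrite /normal_fun -!expRD; congr expR; field.
  by rewrite s0.
rewrite integralZl//; last exact: integrable_normal_pdf.
by rewrite integral_normal_pdf mule1.
Qed.

(** With [q] the square root in the statement, the integrand is 1 / q times the centred normal
    density of standard deviation s / q. Negative [l] is allowed and gives exponential integrability
    of the square. *)
Lemma normal_prob_gauss s l : 0 < s -> 0 < 1 + 2 * l * s ^+ 2 ->
  (\int[normal_prob 0 s]_x (expR (- l * x ^+ 2))%:E =
   ((Num.sqrt (1 + 2 * l * s ^+ 2))^-1)%:E)%E.
Proof.
move=> s0 h; rewrite ge0_integral_normal_prob//; last first.
  by apply/measurable_EFinP; apply: measurableT_comp => //; exact: measurable_funM.
set q := Num.sqrt _; have q0 : 0 < q by rewrite sqrtr_gt0.
have q2 : q ^+ 2 = 1 + 2 * l * s ^+ 2 by rewrite sqr_sqrtr// ltW.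
transitivity (\int[mu]_x ((q^-1)%:E * (normal_pdf 0 (s / q) x)%:E))%E.
  apply: eq_integral => x _; rewrite -!EFinM; congr EFin.
  have sq0 : 0 < s / q by rewrite divr_gt0.
  rewrite !normal_pdfE ?gt_eqF// mulrCA [in RHS]mulrA; congr (_ * _).
    rewrite /normal_peak -invfM; congr (_^-1).
    have qE : q = Num.sqrt (q ^+ 2) by rewrite sqrtr_sqr ger0_norm// ltW.
    rewrite {1}qE -sqrtrM ?sqr_ge0//.
    congr Num.sqrt; rewrite -!mulrnAr; field.
    by rewrite gt_eqF.
  rewrite /normal_fun -expRD; congr expR; rewrite subr0.
  have -> : (s / q) ^+ 2 = s ^+ 2 / (1 + 2 * l * s ^+ 2).
    by rewrite -q2; field; rewrite gt_eqF.
  field.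
  by rewrite !gt_eqF//=.
rewrite integralZl//; last exact: integrable_normal_pdf.
by rewrite integral_normal_pdf mule1.
Qed.

End normal_moments.

Section normal_random_variable.
Context {d : measure_display} {T : measurableType d} {R : realType}.
Variables (P : probability T R) (X : {RV P >-> R}) (s : R).
Hypothesis s0 : 0 < s.
Hypothesis Xs : forall C : set R, measurable C -> P (X @^-1` C) = normal_prob 0 s C.

Let ge0_law (f : R -> R) : measurable_fun [set: R] f -> (forall x, 0 <= f x) ->
  (\int[P]_w (f (X w))%:E = \int[normal_prob 0 s]_x (f x)%:E)%E.
Proof.
move=> mf f0; pose Y : T -> measurableTypeR R := X.
have mY : measurable_fun setT Y := measurable_funPT X.
pose Y' : {mfun T >-> measurableTypeR R} := HB.pack Y (isMeasurableFun.Build _ _ _ _ _ mY).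
transitivity (\int[distribution P Y']_x (f x)%:E)%E.
  by rewrite ge0_integral_distribution//; exact/measurable_EFinP.
apply: eq_measure_integral => A mA _.
by rewrite /= -Xs.
Qed.

Let mX : measurable_fun setT X. Proof. by []. Qed.

Let mX2 : measurable_fun setT (fun w => X w ^+ 2).
Proof. exact: measurable_funX. Qed.

Let integrable_bound (f g : T -> R) c : measurable_fun setT f ->
  measurable_fun setT g ->
  (\int[P]_w (g w)%:E = c%:E)%E -> (forall w, `|f w| <= g w) ->
  P.-integrable setT (EFin \o f).
Proof.
move=> mf mg gc fg; apply/integrableP; split; first exact/measurable_EFinP.
rewrite (@le_lt_trans _ _ c%:E) ?ltry// -gc; apply: ge0_le_integral => //.
- by apply/measurable_EFinP; apply: measurableT_comp.
- exact/measurable_EFinP.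
- by move=> w _; rewrite lee_fin fg.
Qed.

Lemma normal_exp_integrable l : P.-integrable setT (fun w => (expR (l * X w))%:E).
Proof.
apply: (@integrable_bound _ (fun w => expR (l * X w)) (expR (l ^+ 2 * s ^+ 2 / 2))).
- by apply: measurableT_comp => //; exact: measurable_funM.
- by apply: measurableT_comp => //; exact: measurable_funM.
- rewrite (ge0_law (f := fun x => expR (l * x)))//.
    by rewrite normal_probV_expR ?gt_eqF.
  by apply: measurableT_comp => //; exact: measurable_funM.
- by move=> w; rewrite ger0_norm ?expR_ge0.
Qed.

Lemma normal_mgf l : \int[P]_w expR (l * X w) = expR (l ^+ 2 * s ^+ 2 / 2).
Proof.
rewrite /Rintegral (ge0_law (f := fun x => expR (l * x)))//.
  by rewrite normal_probV_expR ?gt_eqF.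
by apply: measurableT_comp => //; exact: measurable_funM.
Qed.

Lemma normal_gauss_integrable l : 0 < 1 + 2 * l * s ^+ 2 ->
  P.-integrable setT (fun w => (expR (- l * X w ^+ 2))%:E).
Proof.
move=> h; apply: (@integrable_bound _ (fun w => expR (- l * X w ^+ 2))
   ((Num.sqrt (1 + 2 * l * s ^+ 2))^-1)).
- by apply: measurableT_comp => //; exact: measurable_funM.
- by apply: measurableT_comp => //; exact: measurable_funM.
- rewrite (ge0_law (f := fun x => expR (- l * x ^+ 2)))//.
    by rewrite normal_prob_gauss.
  by apply: measurableT_comp => //; exact: measurable_funM.
- by move=> w; rewrite ger0_norm ?expR_ge0.
Qed.

Lemma normal_gauss_mean l : 0 < 1 + 2 * l * s ^+ 2 ->
  \int[P]_w expR (- l * X w ^+ 2) = (Num.sqrt (1 + 2 * l * s ^+ 2))^-1.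
Proof.
move=> h; rewrite /Rintegral (ge0_law (f := fun x => expR (- l * x ^+ 2)))//.
  by rewrite normal_prob_gauss.
by apply: measurableT_comp => //; exact: measurable_funM.
Qed.

Lemma normal_sqr_integrable : P.-integrable setT (fun w => (X w ^+ 2)%:E).
Proof.
(* Here 1 + 2 l s^2 = 1/2 is positive, so exp (X^2 / (4 s^2)) is still integrable, and it dominates
   X^2 / (4 s^2). *)
pose l := - (4 * s ^+ 2)^-1.
have s20 : 0 < s ^+ 2 by rewrite exprn_gt0.
have h : 0 < 1 + 2 * l * s ^+ 2.
  rewrite (_ : 1 + _ = 2^-1) ?invr_gt0//.
  by rewrite /l; field; rewrite gt_eqF.
have := integrableZl measurableT (4 * s ^+ 2) (normal_gauss_integrable h).
apply: le_integrable => //; first exact/measurable_EFinP.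
move=> w _; rewrite !lee_fin !ger0_norm ?sqr_ge0 ?mulr_ge0 ?expR_ge0 ?sqr_ge0 ?(ltW s0)//.
rewrite -ler_pdivrMl ?mulr_gt0// /l opprK.
by apply: le_trans (expR_ge1Dx _); rewrite lerDr.
Qed.

Lemma normal_integrable : P.-integrable setT (EFin \o X).
Proof.
have i1 : P.-integrable setT (EFin \o cst 1) by exact: finite_measure_integrable_cst.
have := integrableD measurableT i1 normal_sqr_integrable.
apply: le_integrable => //; first exact/measurable_EFinP.
move=> w _; rewrite !lee_fin (ger0_norm (addr_ge0 _ _)) ?sqr_ge0//.
have := normr_ge0 (X w); rewrite -(real_normK (num_real (X w))) /cst.
by move: `|_| => y y0; nra.
Qed.

(** Taking means in 1 + l X <= exp (l X) bounds an affine function of [l] by one with the same value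
    and zero slope at l = 0; a non-zero mean would break this near 0. *)
Lemma normal_mean : \int[P]_w X w = 0.
Proof.
have bound l : 1 + l * \int[P]_w X w <= expR (l ^+ 2 * s ^+ 2 / 2).
  rewrite -normal_mgf.
  have i1 : P.-integrable setT (EFin \o cst 1) by exact: finite_measure_integrable_cst.
  have il : P.-integrable setT (EFin \o (fun w => l * X w)).
    exact: (integrableZl _ _ normal_integrable).
  rewrite -RintegralZl//; last exact: normal_integrable.
  have <- : \int[P]_w (cst 1 w) = 1 :> R.
    by rewrite Rintegral_cst//= probability_setT mulr1.
  rewrite -RintegralD//; apply: le_Rintegral => //.
  - exact: (integrableD _ i1 il).
  - exact: normal_exp_integrable.
  - by move=> w _; exact: expR_ge1Dx.
apply/eqP/negP => /negP; set e := \int[P]_w X w => e0.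
(* The bound at [l = k e] with [k] small contradicts [e != 0]. *)
have expR_le (y : R) : 0 <= y -> y <= 2^-1 -> expR y <= 1 + 2 * y.
  move=> y0 y2; rewrite -[expR y]invrK -expRN.
  have h : 1 - y <= expR (- y) by exact: expR_ge1Dx.
  apply: (@le_trans _ _ (1 - y)^-1).
    by rewrite lef_pV2// posrE ?expR_gt0//; lra.
  by rewrite -[leLHS]mul1r ler_pdivrMr; nra.
have e2 : 0 < e ^+ 2 by rewrite exprn_even_gt0.
have s2 : 0 < s ^+ 2 by rewrite exprn_gt0.
(* The summands serve three bounds: k <= 1 and k e^2 s^2 <= 1 keep the exponent below 1/2, where
   [expR_le] applies, and k s^2 < 1 makes the quadratic term smaller than the linear one. *)
pose k := (1 + s ^+ 2 + e ^+ 2 * s ^+ 2)^-1.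
have kk : k * (1 + s ^+ 2 + e ^+ 2 * s ^+ 2) = 1.
  by rewrite mulVf// gt_eqF// !addr_gt0// mulr_gt0.
have k0 : 0 < k by rewrite invr_gt0 !addr_gt0// mulr_gt0.
have es : 0 < e ^+ 2 * s ^+ 2 by rewrite mulr_gt0.
have k1 : k <= 1 by nra.
have k2 : k * s ^+ 2 < 1 by nra.
have kes : k * (e ^+ 2 * s ^+ 2) <= 1 by nra.
have := bound (k * e); rewrite -/e.
have -> : (k * e) ^+ 2 * s ^+ 2 / 2 = k * (k * (e ^+ 2 * s ^+ 2)) / 2 by ring.
have -> : k * e * e = k * e ^+ 2 by ring.
move/le_trans => /(_ _ (expR_le _ _ _)) H.
have : 1 + k * e ^+ 2 <= 1 + 2 * (k * (k * (e ^+ 2 * s ^+ 2)) / 2).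
  by apply: H; nra.
have -> : k * (k * (e ^+ 2 * s ^+ 2)) = (k * e ^+ 2) * (k * s ^+ 2) by ring.
have : 0 < k * e ^+ 2 by rewrite mulr_gt0.
by nra.
Qed.

(* Differentiates the Gaussian integral in its parameter at 0: both signs of
   [l] in [1 - l x^2 <= expR (- l x^2)] give the two inequalities. *)
Lemma normal_variance : \int[P]_w X w ^+ 2 = s ^+ 2.
Proof.
have s2 : 0 < s ^+ 2 by rewrite exprn_gt0.
set y := (LHS).
have y0 : 0 <= y by apply: Rintegral_ge0 => w _; exact: sqr_ge0.
have bound l : 0 < 1 + 2 * l * s ^+ 2 ->
    1 - l * y <= (Num.sqrt (1 + 2 * l * s ^+ 2))^-1.
  move=> h; rewrite -normal_gauss_mean//.
  have i1 : P.-integrable setT (EFin \o cst 1) by exact: finite_measure_integrable_cst.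
  have il : P.-integrable setT (EFin \o (fun w => l * X w ^+ 2)).
    exact: (integrableZl _ _ normal_sqr_integrable).
  rewrite /y -RintegralZl//; last exact: normal_sqr_integrable.
  have <- : \int[P]_w (cst 1 w) = 1 :> R.
    by rewrite Rintegral_cst//= probability_setT mulr1.
  rewrite -RintegralB//; apply: le_Rintegral => //.
  - exact: (integrableB _ i1 il).
  - exact: normal_gauss_integrable.
  - by move=> w _; rewrite mulNr; exact: expR_ge1Dx.
(* Squaring removes the root. The left side is 1 + 2 l (s^2 - y) to first order, so small [l] of
   either sign force s^2 = y. *)
have poly l : 0 < 1 + 2 * l * s ^+ 2 -> 0 <= 1 - l * y ->
    (1 - l * y) ^+ 2 * (1 + 2 * l * s ^+ 2) <= 1.
  move=> h ly; have := bound l h; set q := Num.sqrt _.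
  have q0 : 0 < q by rewrite sqrtr_gt0.
  have <- : q ^+ 2 = 1 + 2 * l * s ^+ 2 by rewrite sqr_sqrtr// ltW.
  rewrite -exprMn -[q^-1]mul1r ler_pdivlMr// => b.
  by rewrite exprn_ile1// mulr_ge0// ltW.
clear bound; move: (s ^+ 2) y poly s2 y0 => v y poly v0 y0.
apply/eqP/negP => /negP yv.
(* [K] dominates the coefficients of the higher-order terms. The extra factors 1 + v and 1 + y in
   the denominators of [l] and [m] make the product with [K] both smaller than 1 and at most the
   distance of [v] and [y]. *)
pose K := 1 + 2 * v + y + 4 * y * v + 2 * v * y ^+ 2.
have K1 : 1 <= K by rewrite /K; nra.
have [vy0|vy0] := leP 0 (v - y).
- have vy : 0 < v - y by rewrite lt_def vy0 subr_eq0 eq_sym yv.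
  pose l := (v - y) / (K * (1 + v)).
  have lK : l * (K * (1 + v)) = v - y by rewrite divfK// gt_eqF//; nra.
  have l0 : 0 < l by rewrite divr_gt0//; nra.
  have vyy0 : 0 <= v * y ^+ 2 by rewrite mulr_ge0 ?sqr_ge0// ltW.
  have vy0' : 0 <= v * y by rewrite mulr_ge0// ltW.
  have lK1 : l * K < 1 by nra.
  have h1 : 0 < 1 + 2 * l * v by have := mulr_gt0 l0 v0; lra.
  have h2 : 0 <= 1 - l * y.
    by have : l * y <= l * K; [rewrite ler_pM2l// /K; lra|lra].
  have := poly l h1 h2.
  have -> : (1 - l * y) ^+ 2 * (1 + 2 * l * v) =
    1 + l * (2 * (v - y) + l * (y ^+ 2 - 4 * y * v) + 2 * l * l * v * y ^+ 2) by ring.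
  have : 0 < 2 * (v - y) + l * (y ^+ 2 - 4 * y * v) + 2 * l * l * v * y ^+ 2.
    have a1 : l * (4 * y * v) <= l * K by rewrite ler_pM2l// /K; lra.
    have lK0 : 0 <= l * K by apply: mulr_ge0; [exact: ltW|lra].
    have a2 : l * K <= v - y by rewrite -lK mulrA ler_peMr//; lra.
    have a3 : 0 <= l * y ^+ 2 by rewrite mulr_ge0 ?sqr_ge0// ltW.
    have a4 : 0 <= l * (l * (v * y ^+ 2)).
      by apply: mulr_ge0; [exact: ltW|apply: mulr_ge0 => //; exact: ltW].
    by lra.
  by move=> q; have := mulr_gt0 l0 q; lra.
- have vy : 0 < y - v by nra.
  pose m := (y - v) / (K * (1 + y)).
  have mK : m * (K * (1 + y)) = y - v by rewrite divfK// gt_eqF//; nra.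
  have m0 : 0 < m by rewrite divr_gt0//; nra.
  have mK1 : m * K < 1 by nra.
  have vy0' : 0 <= v * y by rewrite mulr_ge0// ltW.
  have vyy0 : 0 <= v * y ^+ 2 by rewrite mulr_ge0 ?sqr_ge0// ltW.
  have mv : m * (2 * v) < 1.
    by apply: le_lt_trans mK1; rewrite ler_pM2l// /K; nra.
  have m1 : m <= 1 by apply: le_trans (ltW mK1); rewrite ler_peMr// ltW.
  have h1 : 0 < 1 + 2 * (- m) * v by lra.
  have h2 : 0 <= 1 - (- m) * y by have := mulr_ge0 (ltW m0) y0; lra.
  have := poly _ h1 h2.
  have -> : (1 - - m * y) ^+ 2 * (1 + 2 * - m * v) =
    1 + m * (2 * (y - v) + m * (y ^+ 2 - 4 * y * v) - 2 * m * m * v * y ^+ 2) by ring.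
  have : 0 < 2 * (y - v) + m * (y ^+ 2 - 4 * y * v) - 2 * m * m * v * y ^+ 2.
    have a1 : m * (4 * y * v + 2 * v * y ^+ 2) <= m * K.
      by rewrite ler_pM2l// /K; lra.
    have mK0 : 0 <= m * K by apply: mulr_ge0; [exact: ltW|lra].
    have a2 : m * K <= y - v by rewrite -mK mulrA ler_peMr//; lra.
    have a3 : 0 <= m * y ^+ 2 by rewrite mulr_ge0 ?sqr_ge0// ltW.
    have a4 : m * (m * (2 * v * y ^+ 2)) <= m * (2 * v * y ^+ 2).
      by rewrite ler_pM2l// ler_piMl//; lra.
    by lra.
  by move=> q; have := mulr_gt0 m0 q; lra.
Qed.

End normal_random_variable.

(** * Histories of the motions and their independence *)

Section independence.
Context {d : measure_display} {T : measurableType d} {R : realType}.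
Variable P : probability T R.

(** Both sides are finite measures in [A] that agree on the pi-system [G], hence on the
    sigma-algebra that it generates. *)
Lemma g_sigma_algebra_indep (G : set (set T)) (C : set T) :
  G `<=` measurable -> setI_closed G -> G setT -> measurable C ->
  (forall A, G A -> P (A `&` C) = (P A * P C)%E) ->
  forall A, <<s G >> A -> P (A `&` C) = (P A * P C)%E.
Proof.
move=> Gm GI GT mC GC A sA.
have pC : (0 <= fine (P C))%R by rewrite fine_ge0.
have PC : (NngNum pC)%:num%:E = P C by rewrite /= fineK// fin_num_measure.
have -> : (P A * P C)%E = mscale (NngNum pC) P A by rewrite /mscale PC muleC.
rewrite -[LHS]/(mrestr P mC A).
apply: (@g_sigma_algebra_measure_unique _ _ _ G Gm (fun=> setT)) => //.
- by rewrite bigcup_const//; exists 0%N.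
- by move=> B GB; rewrite /= /mrestr /mscale PC GC// muleC.
- by move=> k; rewrite /= /mrestr setTI -ge0_fin_numE// fin_num_measure.
Qed.

(** Independence on rectangles identifies the joint law with the product of the two laws; Tonelli
    then gives integrability of the product and Fubini its mean. *)
Lemma indep_mean_mul (X Y : T -> R) :
  P.-integrable setT (EFin \o X) -> P.-integrable setT (EFin \o Y) ->
  (forall A C : set R, measurable A -> measurable C ->
    P (X @^-1` A `&` Y @^-1` C) = (P (X @^-1` A) * P (Y @^-1` C))%E) ->
  P.-integrable setT (fun w => (X w * Y w)%:E) /\
  \int[P]_w (X w * Y w) = (\int[P]_w X w) * (\int[P]_w Y w).
Proof.
move=> iX iY XY.
have mX : measurable_fun setT X by apply/measurable_EFinP; exact: measurable_int iX.
have mY : measurable_fun setT Y by apply/measurable_EFinP; exact: measurable_int iY.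
pose X' : {RV P >-> R} := HB.pack X (isMeasurableFun.Build _ _ _ _ _ mX).
pose Y' : {RV P >-> R} := HB.pack Y (isMeasurableFun.Build _ _ _ _ _ mY).
have mZ : measurable_fun setT (fun w => (X w, Y w)) by exact: measurable_fun_pair.
pose Z : {mfun T >-> (R * R)%type} := HB.pack (fun w => (X w, Y w))
  (isMeasurableFun.Build _ _ _ _ _ mZ).
pose mu := distribution P X'; pose nu := distribution P Y'.
pose f : R * R -> \bar R := fun z => (z.1 * z.2)%:E.
have mf : measurable_fun setT f.
  by apply/measurable_EFinP; apply: measurable_funM.
have law A : measurable A -> (mu \x nu)%E A = distribution P Z A.
  by move=> mA; exact: product_measure_unique.
have integralE (g : R * R -> \bar R) : measurable_fun setT g -> (forall z, 0 <= g z)%E ->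
    (\int[P]_w g (X w, Y w) = \int[(mu \x nu)%E]_z g z)%E.
  move=> mg g0; transitivity (\int[distribution P Z]_z g z)%E.
    by rewrite ge0_integral_distribution.
  by apply: eq_measure_integral => A mA _; exact/esym/law.
have ifXY : (mu \x nu)%E.-integrable setT f.
  apply/integrable12ltyP => //.
  have -> : (\int[mu]_x \int[nu]_y `|f (x, y)| =
     \int[mu]_x (`|x|%:E * \int[nu]_y `|y|%:E))%E.
    apply: eq_integral => x _; rewrite /f/=.
    under eq_integral do rewrite normrM EFinM.
    rewrite ge0_integralZl//.
    exact/measurable_EFinP.
  have ilaw (V : {RV P >-> R}) : P.-integrable setT (EFin \o V) ->
      (\int[distribution P V]_y `|y|%:E < +oo)%E.
    rewrite ge0_integral_distribution//; last exact/measurable_EFinP.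
    by move/integrableP => [].
  rewrite ge0_integralZr//; last 2 first.
  - exact/measurable_EFinP.
  - exact: integral_ge0.
  apply: lte_mul_pinfty.
  - exact: integral_ge0.
  - by rewrite ge0_fin_numE; [exact: ilaw|exact: integral_ge0].
  - exact: ilaw.
have iXY : P.-integrable setT (fun w => (X w * Y w)%:E).
  apply/integrableP; split.
    by apply/measurable_EFinP; exact: measurable_funM.
  move/integrableP : ifXY => [_].
  by rewrite -(integralE (abse \o f))//; [exact: measurableT_comp|move=> z; exact: abse_ge0].
split => //; rewrite /Rintegral.
have -> : (\int[P]_w (X w * Y w)%:E = \int[(mu \x nu)%E]_z f z)%E.
  transitivity (\int[distribution P Z]_z f z)%E; last first.
    by apply: eq_measure_integral => A mA _; exact/esym/law.
  by rewrite integral_distribution.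
rewrite -integral12_prod_meas1//.
have ilaw (V : {RV P >-> R}) : P.-integrable setT (EFin \o V) ->
    (distribution P V).-integrable setT (EFin : R -> \bar R).
  by move=> iV; exact: integrable_pushforward.
have nuE : (\int[nu]_y y%:E)%E = (\int[P]_w Y w)%:E.
  rewrite /nu integral_distribution//.
  by rewrite fineK// integrable_fin_num.
have -> : (\int[mu]_x fubini_F nu f x = \int[mu]_x (x%:E * (\int[P]_w Y w)%:E))%E.
  apply: eq_integral => x _; rewrite /fubini_F -nuE -integralZl//.
  exact: (ilaw Y').
rewrite integralZr//; last exact: (ilaw X').
rewrite /mu integral_distribution//.
by rewrite fineM//; exact: integrable_fin_num.
Qed.

End independence.

Section histories.
Context {d : measure_display} {T : measurableType d} {R : realType}.
Variables (P : probability T R) (n : nat) (B : 'I_n -> R -> {RV P >-> R}).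

(** Each motion has its own set of times, so that one can form not only the common past but also the
    past of one motion together with the whole paths of the others. *)
Definition history_gen (J : 'I_n -> set R) : set (set T) :=
  \bigcup_j \bigcup_(t in J j) preimage_set_system setT (B j t) measurable.

Definition history (J : 'I_n -> set R) : set (set T) := <<s history_gen J >>.

Lemma history_gen_measurable J : history_gen J `<=` measurable.
Proof.
move=> A [j _ [t _ [C mC <-]]]; rewrite setTI; exact: measurable_funPTI.
Qed.

Lemma history_measurable J : history J `<=` measurable.
Proof.
apply: smallest_sub; first exact: sigma_algebra_measurable.
exact: history_gen_measurable.
Qed.

Lemma sub_history (J K : 'I_n -> set R) : (forall j, J j `<=` K j) ->
  history J `<=` history K.
Proof.
move=> JK; apply: smallest_sub; first exact: smallest_sigma_algebra.
apply: subset_trans (@sub_sigma_algebra _ _ _).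
by move=> A [j _ [t Jt At]]; exists j => //; exists t => //; exact: JK.
Qed.

(** A pi-system that generates the history and on which mutual independence turns probabilities into
    products. *)
Definition cylinders (J : 'I_n -> set R) : set (set T) :=
  [set A | exists2 F : 'I_n -> set T,
    (forall j, sigma_process (J j) (fun t => B j t) (F j)) & A = \bigcap_j F j].

Lemma sigma_process_measurable (J : set R) j :
  sigma_process J (fun t => B j t) `<=` measurable.
Proof.
apply: smallest_sub; first exact: sigma_algebra_measurable.
by move=> A [t _ [C mC <-]]; rewrite setTI; exact: measurable_funPTI.
Qed.

Lemma sub_sigma_process (J K : set R) j : J `<=` K ->
  sigma_process J (fun t => B j t) `<=` sigma_process K (fun t => B j t).
Proof.
move=> JK; apply: smallest_sub; first exact: smallest_sigma_algebra.
apply: subset_trans (@sub_sigma_algebra _ _ _).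
by move=> A [t Jt At]; exists t => //; exact: JK.
Qed.

Lemma sigma_processT (J : set R) j : sigma_process J (fun t => B j t) setT.
Proof.
pose G := \bigcup_(t in J) preimage_set_system setT (B j t : T -> R) measurable.
exact: (@measurableT _ (g_sigma_algebraType G)).
Qed.

Lemma sigma_processI (J : set R) j : setI_closed (sigma_process J (fun t => B j t)).
Proof.
pose G := \bigcup_(t in J) preimage_set_system setT (B j t : T -> R) measurable.
by move=> A C hA hC; exact: (@measurableI _ (g_sigma_algebraType G)).
Qed.

Lemma cylinders_setI J : setI_closed (cylinders J).
Proof.
move=> _ _ [F hF ->] [G hG ->]; exists (fun j => F j `&` G j).
  by move=> j; exact: sigma_processI.
by rewrite bigcapI.
Qed.

Lemma cylinders_measurable J : cylinders J `<=` measurable.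
Proof.
move=> _ [F hF ->]; apply: fin_bigcap_measurable => // j _.
exact: (@sigma_process_measurable (J j) j).
Qed.

Lemma history_cylinders J : history J `<=` <<s cylinders J >>.
Proof.
apply: smallest_sub; first exact: smallest_sigma_algebra.
apply: subset_trans (@sub_sigma_algebra _ _ _).
move=> A [j _ [t Jt At]].
exists (fun i => if i == j then A else setT).
  move=> i; case: eqP => [->|_]; last exact: sigma_processT.
  by apply: sub_sigma_algebra; exists t.
apply/seteqP; split => [w Aw i _|w /(_ j I)]; last by rewrite eqxx.
by case: eqP.
Qed.

Hypothesis B_brownian : forall i, standard_brownian_motion (B i).
Hypothesis B_independent : independent_processes B.

(** Only motion [i] has to be restricted to times up to [s]. On a cylinder the other motions split
    off by mutual independence, and within motion [i] the increment is independent of its own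
    past. *)
Lemma history_increment_indep J i s t : 0 <= s -> s < t ->
  J i `<=` `[0, s] -> (forall j, J j `<=` `[0, +oo[) ->
  forall (A : set T) (C : set R), history J A -> measurable C ->
    P (A `&` (B i t \- B i s) @^-1` C) = (P A * P ((B i t \- B i s)%R @^-1` C))%E.
Proof.
move=> s0 st Ji J0 A C /history_cylinders hA mC.
pose E := (B i t \- B i s) @^-1` C.
have mD : measurable_fun setT (B i t \- B i s) by exact: measurable_funB.
have mE : measurable E by rewrite -[E]setTI; exact: mD.
apply: (g_sigma_algebra_indep (G := cylinders J)) => //.
- exact: cylinders_measurable.
- exact: cylinders_setI.
- exists (fun=> setT) => [j|]; first exact: sigma_processT.
  by apply/seteqP; split.
have mutual (F : 'I_n -> set T) :
    (forall j, sigma_process `[0, +oo[ (fun t => B j t) (F j)) ->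
    P (\bigcap_j F j) = (\prod_j P (F j))%E.
  move=> hF; have := B_independent (J := [set: 'I_n]%SET) (A := F).
  have -> : [set` [set: 'I_n]%SET] = setT by apply/seteqP; split => j // _; exact: finset.in_setT.
  move=> ->; last by move=> j _; exact: hF.
  by apply: eq_bigl => j; rewrite inE.
move=> _ [F hF ->].
have hF0 j : sigma_process `[0, +oo[ (fun t => B j t) (F j).
  by apply: sub_sigma_process (hF j); exact: J0.
have hE : sigma_process `[0, +oo[ (fun t => B i t) E.
  pose G := \bigcup_(t in `[0, +oo[) preimage_set_system setT (B i t : T -> R) measurable.
  have mG u : 0 <= u -> measurable_fun setT (B i u : g_sigma_algebraType G -> R).
    move=> u0 _ U mU; apply: sub_sigma_algebra; exists u; last by exists U.
    by rewrite /= in_itv/= u0.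
  have : measurable_fun setT (B i t \- B i s : g_sigma_algebraType G -> R).
    by apply: measurable_funB; apply: mG => //; rewrite (le_trans s0)// ltW.
  by move=> /(_ measurableT C mC); rewrite setTI.
(* The increment event is absorbed into the factor of motion [i], so that the intersection is again
   a family with one event per motion. *)
pose F' j := if j == i then F i `&` E else F j.
have -> : \bigcap_j F j `&` E = \bigcap_j F' j.
  apply/seteqP; split => [w [Fw Ew] j _|w F'w].
    by rewrite /F'; case: eqP => _; [split => //|]; exact: Fw.
  split => [j _|]; last by have := F'w i I; rewrite /F' eqxx => -[].
  by have := F'w j I; rewrite /F'; case: eqP => [->[]|].
rewrite !mutual//; last first.
  move=> j; rewrite /F'; case: eqP => [->|_]; last exact: hF0.
  by apply: sigma_processI.
rewrite (bigD1 i)//= [in RHS](bigD1 i)//= {1}/F' eqxx.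
rewrite (bm_independent_increments (B_brownian i) s0 st)//; last first.
  exact: sub_sigma_process (hF i).
under eq_bigr => j ji do rewrite /F' (negbTE ji).
by rewrite -muleA [RHS]muleAC -muleA.
Qed.

End histories.

(** * Integrable and square-integrable random variables *)

Section square_integrable.
Context {d : measure_display} {T : measurableType d} {R : realType}.
Variable P : probability T R.
Implicit Types f g : T -> R.

Definition square_integrable f :=
  measurable_fun setT f /\ P.-integrable setT (fun w => (f w ^+ 2)%:E).

Lemma integrable_measurable f :
  P.-integrable setT (EFin \o f) -> measurable_fun setT f.
Proof. by move=> /measurable_int /measurable_EFinP. Qed.

Lemma le_integrable_real f g : measurable_fun setT f ->
  P.-integrable setT (EFin \o g) -> (forall w, `|f w| <= g w) ->
  P.-integrable setT (EFin \o f).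
Proof.
move=> mf ig fg; apply: le_integrable ig => //; first exact/measurable_EFinP.
by move=> w _; rewrite lee_fin (le_trans (fg w))// ler_norm.
Qed.

Lemma integrableD_real f g :
  P.-integrable setT (EFin \o f) -> P.-integrable setT (EFin \o g) ->
  P.-integrable setT (EFin \o (fun w => f w + g w)).
Proof. by move=> hf hg; exact: (integrableD measurableT hf hg). Qed.

Lemma integrableB_real f g :
  P.-integrable setT (EFin \o f) -> P.-integrable setT (EFin \o g) ->
  P.-integrable setT (EFin \o (fun w => f w - g w)).
Proof. by move=> hf hg; exact: (integrableB measurableT hf hg). Qed.

Lemma integrableZ_real (k : R) f :
  P.-integrable setT (EFin \o f) ->
  P.-integrable setT (EFin \o (fun w => k * f w)).
Proof. by move=> hf; exact: (integrableZl measurableT k hf). Qed.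

Lemma integrable_cst_real (k : R) : P.-integrable setT (EFin \o (fun=> k)).
Proof. exact: finite_measure_integrable_cst. Qed.

Lemma mean_cst (k : R) : \int[P]_w k = k.
Proof. by rewrite Rintegral_cst//= probability_setT mulr1. Qed.

Lemma square_integrable_mul f g : square_integrable f -> square_integrable g ->
  P.-integrable setT (EFin \o (fun w => f w * g w)).
Proof.
move=> [mf sf] [mg sg]; apply: (@le_integrable_real _ (fun w => f w ^+ 2 + g w ^+ 2)).
- exact: measurable_funM.
- exact: integrableD_real.
- move=> w; rewrite normrM -(real_normK (num_real (f w))) -(real_normK (num_real (g w))).
  move: (normr_ge0 (f w)) (normr_ge0 (g w)); move: `|f w| `|g w| => a b a0 b0.
  by nra.
Qed.

Lemma square_integrable_cst (k : R) : square_integrable (fun=> k).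
Proof.
split => //; exact: (integrable_cst_real (k ^+ 2)).
Qed.

Lemma square_integrable_integrable f : square_integrable f ->
  P.-integrable setT (EFin \o f).
Proof.
move=> sf; have := square_integrable_mul sf (square_integrable_cst 1).
by apply: eq_integrable => // w _ /=; rewrite mulr1.
Qed.

Lemma square_integrableM f g : measurable_fun setT f -> (forall w, `|f w| <= 1) ->
  square_integrable g -> square_integrable (fun w => f w * g w).
Proof.
move=> mf f1 [mg sg]; split; first exact: measurable_funM.
apply: (@le_integrable_real _ (fun w => g w ^+ 2)) => //.
  by apply: measurable_funX; exact: measurable_funM.
move=> w; rewrite exprMn normrM [`|g w ^+ 2|]ger0_norm ?sqr_ge0//.
by rewrite ler_piMl ?sqr_ge0// normrX exprn_ile1.
Qed.

Lemma square_integrableD f g : square_integrable f -> square_integrable g ->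
  square_integrable (fun w => f w + g w).
Proof.
move=> [mf sf] [mg sg]; split; first exact: measurable_funD.
apply: (@le_integrable_real _ (fun w => 2 * (f w ^+ 2 + g w ^+ 2))).
- by apply: measurable_funX; exact: measurable_funD.
- by apply: integrableZ_real; exact: integrableD_real.
- by move=> w; rewrite ger0_norm ?sqr_ge0//; have := sqr_ge0 (f w - g w); nra.
Qed.

Lemma square_integrableZ (k : R) f : square_integrable f ->
  square_integrable (fun w => k * f w).
Proof.
move=> [mf sf]; split; first exact: measurable_funM.
have := integrableZ_real (k ^+ 2) sf.
by apply: eq_integrable => // w _ /=; rewrite exprMn.
Qed.

Lemma square_integrableB f g : square_integrable f -> square_integrable g ->
  square_integrable (fun w => f w - g w).
Proof.
move=> sf /(square_integrableZ (-1)) sg.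
have -> : (fun w => f w - g w) = (fun w => f w + -1 * g w).
  by apply/funext => w; rewrite mulN1r.
exact: square_integrableD.
Qed.

Lemma square_integrable_sum (I : Type) (r : seq I) (F : I -> T -> R) :
  (forall i, square_integrable (F i)) ->
  square_integrable (fun w => \sum_(i <- r) F i w).
Proof.
move=> sF; elim: r => [|i r IH].
  have -> : (fun w => \sum_(i <- [::]) F i w) = fun=> 0.
    by apply/funext => w; rewrite big_nil.
  exact: square_integrable_cst.
have -> : (fun w => \sum_(j <- i :: r) F j w) = fun w => F i w + \sum_(j <- r) F j w.
  by apply/funext => w; rewrite big_cons.
exact: square_integrableD.
Qed.

Lemma square_integrable_indic f A : measurable A -> square_integrable f ->
  square_integrable (fun w => \1_A w * f w).
Proof.
move=> mA; apply: square_integrableM; first exact: measurable_indic.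
by move=> w; rewrite indicE; case: (_ \in _); rewrite ?normr1 ?normr0.
Qed.

Lemma mean_sum (I : Type) (r : seq I) (F : I -> T -> R) :
  (forall i, P.-integrable setT (EFin \o F i)) ->
  P.-integrable setT (EFin \o (fun w => \sum_(i <- r) F i w)) /\
  \int[P]_w (\sum_(i <- r) F i w) = \sum_(i <- r) \int[P]_w F i w.
Proof.
move=> iF; elim: r => [|i r [IH1 IH2]].
  under [in X in X /\ _]eq_fun do rewrite big_nil.
  rewrite big_nil; split; first exact: integrable_cst_real.
  by under eq_Rintegral do rewrite big_nil; exact: mean_cst.
have -> : (fun w => \sum_(j <- i :: r) F j w) = fun w => F i w + \sum_(j <- r) F j w.
  by apply/funext => w; rewrite big_cons.
by rewrite big_cons -IH2 RintegralD//; split => //; exact: integrableD_real.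
Qed.

End square_integrable.

(** * Increments against adapted random variables *)

Section adapted.
Context {d : measure_display} {T : measurableType d} {R : realType}.
Variables (P : probability T R) (n : nat) (B : 'I_n -> R -> {RV P >-> R}).

Definition adapted (J : 'I_n -> set R) (Z : T -> R) :=
  measurable_fun setT (Z : g_sigma_algebraType (history_gen B J) -> R).

Lemma adapted_preimage J Z (C : set R) : adapted J Z -> measurable C ->
  history B J (Z @^-1` C).
Proof. by move=> aZ mC; have := aZ measurableT C mC; rewrite setTI. Qed.

Lemma adapted_measurable J Z : adapted J Z -> measurable_fun setT Z.
Proof.
move=> aZ _ C mC; rewrite setTI; apply: history_measurable.
exact: adapted_preimage aZ mC.
Qed.

Lemma sub_adapted (J K : 'I_n -> set R) Z : (forall j, J j `<=` K j) ->
  adapted J Z -> adapted K Z.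
Proof.
move=> JK aZ _ C mC; rewrite setTI; apply: (sub_history JK).
exact: adapted_preimage aZ mC.
Qed.

Lemma adapted_path J i t : J i t -> adapted J (B i t).
Proof.
move=> Jt _ C mC; rewrite setTI; apply: sub_sigma_algebra.
by exists i => //; exists t => //; exists C => //; rewrite setTI.
Qed.

Lemma adapted_indic J A : history B J A -> adapted J (\1_A : T -> R).
Proof.
move=> hA; exact: (@measurable_indic _ (g_sigma_algebraType (history_gen B J))).
Qed.

Hypothesis B_brownian : forall i, standard_brownian_motion (B i).
Hypothesis B_independent : independent_processes B.

Let incr_law i s t : 0 <= s -> s < t -> forall C : set R, measurable C ->
  P ((B i t \- B i s : {RV P >-> R}) @^-1` C) = normal_prob 0 (Num.sqrt (t - s)) C.
Proof. by move=> s0 st C mC; exact: (bm_normal_increments (B_brownian i)). Qed.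

Let sqrt_gt0 (s t : R) : s < t -> 0 < Num.sqrt (t - s).
Proof. by move=> st; rewrite sqrtr_gt0 subr_gt0. Qed.

Lemma increment_square_integrable i s t : 0 <= s -> s < t ->
  square_integrable P (fun w => B i t w - B i s w).
Proof.
move=> s0 st; split; first exact: measurable_funB.
exact: (normal_sqr_integrable (sqrt_gt0 st) (@incr_law i s t s0 st)).
Qed.

Lemma path_square_integrable i t : 0 <= t -> square_integrable P (B i t).
Proof.
rewrite le_eqVlt => /orP[/eqP <-|t0].
  have -> : (B i 0 : T -> R) = fun=> 0.
    by apply/funext => w; exact: (bm_start (B_brownian i)).
  exact: square_integrable_cst.
have := @increment_square_integrable i 0 t (lexx _) t0.
congr square_integrable; apply/funext => w.
by rewrite (bm_start (B_brownian i)) subr0.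
Qed.

(* Larger than the common past up to [s], but the increments of [B i] after [s]
   are still independent of it; needed for products of increments of two
   different motions. *)
Definition past_or_other (i : 'I_n) (s : R) (j : 'I_n) : set R :=
  if j == i then [set` `[0, s]] else [set` `[0, +oo[].

(** [Z] is independent of the increment, so means multiply and the normal moments 0 and t - s come
    out: the martingale property and the quadratic variation on which the discrete isometry
    rests. *)
Lemma increment_mean i s t Z : 0 <= s -> s < t ->
  adapted (past_or_other i s) Z -> P.-integrable setT (EFin \o Z) ->
  [/\ P.-integrable setT (EFin \o (fun w => Z w * (B i t w - B i s w))),
      \int[P]_w (Z w * (B i t w - B i s w)) = 0,
      P.-integrable setT (EFin \o (fun w => Z w * (B i t w - B i s w) ^+ 2)) &
      \int[P]_w (Z w * (B i t w - B i s w) ^+ 2) = (t - s) * \int[P]_w Z w].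
Proof.
move=> s0 st aZ iZ.
have [mX sX] := @increment_square_integrable i s t s0 st.
have iX := square_integrable_integrable (conj mX sX).
have ind A C : measurable A -> measurable C ->
    P (Z @^-1` A `&` (B i t \- B i s) @^-1` C) =
    (P (Z @^-1` A) * P ((B i t \- B i s)%R @^-1` C))%E.
  move=> mA mC; apply: (history_increment_indep (J := past_or_other i s) B_brownian
    B_independent s0 st _ _ _ mC) => [||].
  - by rewrite /past_or_other eqxx.
  - move=> j x; rewrite /past_or_other; case: ifP => _; rewrite /= !in_itv/= andbT; last by [].
    by case/andP.
  - exact: adapted_preimage aZ mA.
have [i1 e1] := indep_mean_mul iZ iX ind.
have [i2 e2] : P.-integrable setT (EFin \o (fun w => Z w * (B i t w - B i s w) ^+ 2)) /\
    \int[P]_w (Z w * (B i t w - B i s w) ^+ 2) =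
    \int[P]_w Z w * \int[P]_w (B i t w - B i s w) ^+ 2.
  apply: indep_mean_mul => // A C mA mC.
  apply: (ind A ((fun x => x ^+ 2) @^-1` C)) => //.
  by rewrite -[X in measurable X]setTI; exact: measurable_funX.
have sq0 := sqrt_gt0 st; have law := @incr_law i s t s0 st.
have m0 : \int[P]_w (B i t w - B i s w) = 0 := normal_mean sq0 law.
have v0 : \int[P]_w (B i t w - B i s w) ^+ 2 = Num.sqrt (t - s) ^+ 2 :=
  normal_variance sq0 law.
split => //; first by rewrite e1 m0 mulr0.
by rewrite e2 v0 mulrC sqr_sqrtr// subr_ge0 ltW.
Qed.

End adapted.

(** * Discrete stochastic integrals *)

Section discrete_isometry.
Context {d : measure_display} {T : measurableType d} {R : realType}.
Variables (P : probability T R) (n : nat) (B : 'I_n -> R -> {RV P >-> R}).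
Hypothesis B_brownian : forall i, standard_brownian_motion (B i).
Hypothesis B_independent : independent_processes B.

Definition past (s : R) (_ : 'I_n) : set R := [set` `[0, s]].

Lemma sub_past s t : s <= t -> forall j, past s j `<=` past t j.
Proof.
move=> st j x; rewrite /past /= !in_itv/= => /andP[-> xs].
exact: le_trans xs st.
Qed.

Lemma past_sub_past_or_other i s j : past s j `<=` past_or_other i s j.
Proof.
by rewrite /past_or_other /past; case: ifP => // _ x; rewrite /= !in_itv/= => /andP[->].
Qed.

(** The martingale transform, or discrete stochastic integral, of [J] against [B i] along the grid
    [t]. *)
Definition transform (i : 'I_n) (t : nat -> R) (J : nat -> T -> R) (m : nat) (w : T) : R :=
  \sum_(k < m) J k w * (B i (t k.+1) w - B i (t k) w).

Lemma transformS i t J m w : transform i t J m.+1 w =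
  transform i t J m w + J m w * (B i (t m.+1) w - B i (t m) w).
Proof. by rewrite /transform big_ord_recr. Qed.

(** The bound 1 suffices: the integrands below are indicators and differences of nested
    indicators. *)
Definition predictable (t : nat -> R) (J : nat -> T -> R) : Prop :=
  forall k, adapted B (past (t k)) (J k) /\ forall w, `|J k w| <= 1.

Variable t : nat -> R.
Hypotheses (t0 : 0 <= t 0%N) (tS : forall k, t k < t k.+1).

Let t_ge0 k : 0 <= t k.
Proof. by elim: k => // k IH; rewrite (le_trans IH)// ltW. Qed.

Lemma transform_adapted i J m : predictable t J ->
  adapted B (past (t m)) (transform i t J m).
Proof.
move=> hJ; elim: m => [|m IH].
  rewrite (_ : transform _ _ _ _ = fun=> 0); last first.
    by apply/funext => w; rewrite /transform big_ord0.
  exact: measurable_cst.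
rewrite (_ : transform _ _ _ _ = fun w => transform i t J m w +
    J m w * (B i (t m.+1) w - B i (t m) w)); last exact/funext/transformS.
have sub := sub_past (ltW (tS m)).
apply: measurable_funD; first exact: sub_adapted sub IH.
apply: measurable_funM; first exact: sub_adapted sub (hJ m).1.
by apply: measurable_funB; apply: adapted_path;
  rewrite /past /= in_itv/= t_ge0//= ltW.
Qed.

Lemma transform_square_integrable i J m : predictable t J ->
  square_integrable P (transform i t J m).
Proof.
move=> hJ; rewrite /transform.
pose F k w := J k w * (B i (t k.+1) w - B i (t k) w).
rewrite (_ : (fun w => _) = fun w => \sum_(k <- index_enum 'I_m) F k w)//.
apply: square_integrable_sum => k.
apply: square_integrableM; last exact: increment_square_integrable.
  exact: adapted_measurable (hJ k).1.
exact: (hJ k).2.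
Qed.

Lemma predictable_measurable J k : predictable t J -> measurable_fun setT (J k).
Proof. by move=> hJ; exact: adapted_measurable (hJ k).1. Qed.

Lemma transform_mean i J m : predictable t J ->
  \int[P]_w transform i t J m w = 0.
Proof.
move=> hJ; have iJ k : P.-integrable setT (EFin \o J k).
  apply: (@le_integrable_real _ _ _ _ _ (fun=> 1)).
  - exact: predictable_measurable.
  - exact: integrable_cst_real.
  - exact: (hJ k).2.
have H k : [/\ P.-integrable setT (EFin \o (fun w => J k w * (B i (t k.+1) w - B i (t k) w))),
      \int[P]_w (J k w * (B i (t k.+1) w - B i (t k) w)) = 0, _ & _] :=
  increment_mean B_brownian B_independent (t_ge0 k) (tS k)
   (sub_adapted (@past_sub_past_or_other i (t k)) (hJ k).1) (iJ k).
have [|_ ->] := @mean_sum _ _ _ P _ (index_enum 'I_m)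
  (fun k : 'I_m => fun w => J k w * (B i (t k.+1) w - B i (t k) w)).
  by move=> k; have [] := H k.
by apply: big1 => k _; have [] := H k.
Qed.

(** Induction on [m]. In the product of the two sums, each cross term of a past value with the last
    increment has mean 0, and the product of the two last increments contributes only for i = j. *)
Lemma transform_covariance i j J K m : predictable t J -> predictable t K ->
  \int[P]_w (transform i t J m w * transform j t K m w) =
  (i == j)%:R * \sum_(k < m) (t k.+1 - t k) * \int[P]_w (J k w * K k w).
Proof.
move=> hJ hK; elim: m => [|m IH].
  rewrite big_ord0 mulr0 -[RHS](mean_cst P 0).
  by apply: eq_Rintegral => w _; rewrite /transform big_ord0 mul0r.
rewrite big_ord_recr/= mulrDr -IH.
set X := transform i t J m; set Y := transform j t K m.
pose xi w := B i (t m.+1) w - B i (t m) w.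
pose xj w := B j (t m.+1) w - B j (t m) w.
have sX : square_integrable P X by exact: transform_square_integrable.
have sY : square_integrable P Y by exact: transform_square_integrable.
have sxi : square_integrable P xi by exact: increment_square_integrable.
have sxj : square_integrable P xj by exact: increment_square_integrable.
have sJ : square_integrable P (J m).
  have := square_integrableM (predictable_measurable m hJ) (hJ m).2 (square_integrable_cst P 1).
  by congr square_integrable; apply/funext => w; rewrite mulr1.
have sK : square_integrable P (K m).
  have := square_integrableM (predictable_measurable m hK) (hK m).2 (square_integrable_cst P 1).
  by congr square_integrable; apply/funext => w; rewrite mulr1.
have aX : adapted B (past (t m)) X by exact: transform_adapted.
have aY : adapted B (past (t m)) Y by exact: transform_adapted.
have aXK : adapted B (past (t m)) (fun w => X w * K m w).
  by apply: measurable_funM; [exact: aX|exact: (hK m).1].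
have aYJ : adapted B (past (t m)) (fun w => Y w * J m w).
  by apply: measurable_funM; [exact: aY|exact: (hJ m).1].
have aJK : adapted B (past (t m)) (fun w => J m w * K m w).
  by apply: measurable_funM; [exact: (hJ m).1|exact: (hK m).1].
have [i1 e1 _ _] := increment_mean B_brownian B_independent (t_ge0 m) (tS m)
   (sub_adapted (@past_sub_past_or_other j (t m)) aXK) (square_integrable_mul sX sK).
have [i2 e2 _ _] := increment_mean B_brownian B_independent (t_ge0 m) (tS m)
   (sub_adapted (@past_sub_past_or_other i (t m)) aYJ) (square_integrable_mul sY sJ).
have [i3 e3] : P.-integrable setT (EFin \o (fun w => J m w * K m w * xi w * xj w)) /\
    \int[P]_w (J m w * K m w * xi w * xj w) =
    (i == j)%:R * ((t m.+1 - t m) * \int[P]_w (J m w * K m w)).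
  have [ij|ij] := eqVneq i j.
    have [_ _ i4 e4] := increment_mean B_brownian B_independent (t_ge0 m) (tS m)
     (sub_adapted (@past_sub_past_or_other i (t m)) aJK) (square_integrable_mul sJ sK).
    rewrite mul1r -e4.
    have -> : (fun w => J m w * K m w * xi w * xj w) = (fun w => J m w * K m w *
       (B i (t m.+1) w - B i (t m) w) ^+ 2).
      by apply/funext => w; rewrite /xj -ij -mulrA expr2.
    by [].
  (* [xi] looks beyond time [t m], but along the other motion [B i]; it may therefore be counted
     with the integrand, and the increment of [B j] still has mean 0 against it. *)
  have aZ : adapted B (past_or_other j (t m)) (fun w => J m w * K m w * xi w).
    apply: measurable_funM.
      by apply: sub_adapted aJK; exact: past_sub_past_or_other.
    by apply: measurable_funB; apply: adapted_path;
      rewrite /past_or_other (negbTE ij) /= in_itv/= t_ge0.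
  have sKxi : square_integrable P (fun w => K m w * xi w).
    by apply: square_integrableM => //; [exact: predictable_measurable|exact: (hK m).2].
  have iZ : P.-integrable setT (EFin \o (fun w => J m w * K m w * xi w)).
    have := square_integrable_mul sJ sKxi.
    by apply: eq_integrable => // w _ /=; rewrite mulrA.
  have [i4 e4 _ _] := increment_mean B_brownian B_independent (t_ge0 m) (tS m) aZ iZ.
  by rewrite mul0r.
have iXY := square_integrable_mul sX sY.
transitivity (\int[P]_w (X w * Y w + (X w * K m w * xj w + (Y w * J m w * xi w +
    J m w * K m w * xi w * xj w)))).
  by apply: eq_Rintegral => w _; rewrite !transformS -/X -/Y /xi /xj; ring.
have i23 := integrableD_real i2 i3; have i123 := integrableD_real i1 i23.
rewrite (RintegralD measurableT iXY i123) (RintegralD measurableT i1 i23).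
by rewrite (RintegralD measurableT i2 i3) e1 e2 e3 !add0r.
Qed.

End discrete_isometry.

(** * Limits in mean square *)

Section mean_square_limit.
Context {d : measure_display} {T : measurableType d} {R : realType}.
Variable P : probability T R.
Implicit Types f g : T -> R.

(** Cauchy-Schwarz, from the non-negative quadratic E (f + x g)^2 in [x]. *)
Lemma mean_mul_sqr_le f g : square_integrable P f -> square_integrable P g ->
  (\int[P]_w (f w * g w)) ^+ 2 <= (\int[P]_w f w ^+ 2) * (\int[P]_w g w ^+ 2).
Proof.
move=> sf sg; have ifg := square_integrable_mul sf sg.
set a := \int[P]_w f w ^+ 2; set b := \int[P]_w (f w * g w).
set c := \int[P]_w g w ^+ 2.
have quad x : 0 <= a + 2 * x * b + x ^+ 2 * c.
  have -> : a + 2 * x * b + x ^+ 2 * c = \int[P]_w (f w + x * g w) ^+ 2.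
    transitivity (\int[P]_w (f w ^+ 2 + (2 * x * (f w * g w) + x ^+ 2 * g w ^+ 2))).
      have i1 := integrableZ_real (2 * x) ifg.
      have i2 := integrableZ_real (x ^+ 2) sg.2.
      have i3 := integrableD_real i1 i2.
      rewrite (RintegralD measurableT sf.2 i3) (RintegralD measurableT i1 i2).
      by rewrite !RintegralZl//; [rewrite addrA|exact: sg.2].
    by apply: eq_Rintegral => w _; ring.
  by apply: Rintegral_ge0 => w _; exact: sqr_ge0.
have c0 : 0 <= c by apply: Rintegral_ge0 => w _; exact: sqr_ge0.
move: c0; rewrite le_eqVlt => /orP[/eqP c0|c0]; last first.
  have := quad (- b / c).
  have -> : a + 2 * (- b / c) * b + (- b / c) ^+ 2 * c = (a * c - b ^+ 2) / c.
    by field; rewrite gt_eqF.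
  by rewrite pmulr_lge0 ?invr_gt0// subr_ge0.
rewrite -c0 mulr0; have [->|b0] := eqVneq b 0; first by rewrite expr0n.
(* For c = 0 the quadratic is affine with slope 2 b, and this [x] gives it the value -1. *)
have := quad (- (a + 1) / (2 * b)).
have -> : a + 2 * (- (a + 1) / (2 * b)) * b + (- (a + 1) / (2 * b)) ^+ 2 * c = -1.
  by rewrite -c0; field.
by rewrite lerNr oppr0 ler10.
Qed.

(** Fatou's lemma on the event [D] of full measure; [g] is square-integrable as the sum of g - h and
    h. *)
Lemma mean_sqrB_le_lim (D : set T) (f : nat -> T -> R) g h (e : R) :
  measurable D -> P (~` D) = 0%E ->
  (forall m, square_integrable P (f m)) -> square_integrable P h ->
  measurable_fun setT g ->
  (forall w, D w -> f m w @[m --> \oo] --> g w) ->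
  (forall m, \int[P]_w (f m w - h w) ^+ 2 <= e) ->
  square_integrable P g /\ \int[P]_w (g w - h w) ^+ 2 <= e.
Proof.
move=> mD D0 sf sh mg fg fe.
have mh := sh.1.
have sfh m := square_integrableB (sf m) sh.
have mgh : measurable_fun setT (fun w => (g w - h w) ^+ 2).
  by apply: measurable_funX; exact: measurable_funB.
have int_le : (\int[P]_w ((g w - h w) ^+ 2)%:E <= e%:E)%E.
  have -> : (\int[P]_w ((g w - h w) ^+ 2)%:E = \int[P]_(w in D) ((g w - h w) ^+ 2)%:E)%E.
    rewrite (@ge0_negligible_integral _ _ _ _ setT (~` D))//.
    - by rewrite setTD setCK.
    - exact: measurableC.
    - exact/measurable_EFinP.
    - by move=> w _; rewrite lee_fin sqr_ge0.
  have fe' m : (\int[P]_(w in D) ((f m w - h w) ^+ 2)%:E <= e%:E)%E.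
    apply: (@le_trans _ _ (\int[P]_w ((f m w - h w) ^+ 2)%:E)%E).
      apply: ge0_subset_integral => //.
      - exact: measurable_int (sfh m).2.
      - by move=> w _; rewrite lee_fin sqr_ge0.
    rewrite -(@fineK _ (\int[P]_w _)%E) ?lee_fin; first exact: fe.
    by apply: integrable_fin_num => //; exact: (sfh m).2.
  apply: (@le_trans _ _ (limn_einf (fun m => \int[P]_(w in D) ((f m w - h w) ^+ 2)%:E)%E)).
    apply: le_trans (fatou _ mD _ _).
    - rewrite le_eqVlt; apply/orP; left; apply/eqP; apply: eq_integral => w.
      rewrite inE => Dw; apply/esym; apply: (cvg_limn_einf_sup _).1.
      apply: cvg_EFin; first exact: nearW.
      apply: (cvg_comp (fun m => f m w - h w) (fun x => x ^+ 2)).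
        by apply: cvgB; [exact: fg|exact: cvg_cst].
      exact: sqr_continuous.
    - by move=> m; apply: measurable_funTS; exact: measurable_int (sfh m).2.
    - by move=> m w _; rewrite lee_fin sqr_ge0.
  rewrite limn_einf_lim; apply: lime_le; first exact: is_cvg_einfs.
  apply: nearW => m; apply: le_trans (fe' m).
  by apply: ereal_inf_lbound; exists m => /=.
have sgh : square_integrable P (fun w => g w - h w).
  split; first exact: measurable_funB.
  apply/integrableP; split; first exact/measurable_EFinP.
  under eq_integral do rewrite gee0_abs ?lee_fin ?sqr_ge0//.
  by rewrite (le_lt_trans int_le)// ltry.
split.
  have := square_integrableD sgh sh.
  by congr square_integrable; apply/funext => w; rewrite subrK.
rewrite -lee_fin /Rintegral fineK//.
by apply: integrable_fin_num => //; exact: sgh.2.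
Qed.

(** Taking for [h] a member [f m] of the sequence itself in the preceding bound turns the Cauchy
    estimate into a rate of convergence to the pointwise limit. *)
Lemma mean_square_limit (D : set T) (f : nat -> T -> R) g (e : nat -> R) :
  measurable D -> P (~` D) = 0%E ->
  (forall m, square_integrable P (f m)) ->
  measurable_fun setT g ->
  (forall w, D w -> f m w @[m --> \oo] --> g w) ->
  (forall m k, (m <= k)%N -> \int[P]_w (f k w - f m w) ^+ 2 <= e m) ->
  e m @[m --> \oo] --> 0 ->
  square_integrable P g /\ \int[P]_w (f m w - g w) ^+ 2 @[m --> \oo] --> 0.
Proof.
move=> mD D0 sf mg fg fe e0.
have bound m : square_integrable P g /\ \int[P]_w (g w - f m w) ^+ 2 <= e m.
  apply: (@mean_sqrB_le_lim D (fun k => f (k + m)%N)) => // [w Dw|k].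
  - by rewrite (cvg_shiftn m (fun k => f k w)); exact: fg.
  - exact/fe/leq_addl.
split; first exact: (bound 0%N).1.
apply: (@squeeze_cvgr _ _ _ _ (fun=> 0) e) => //; last exact: cvg_cst.
apply: nearW => m; apply/andP; split.
  by apply: Rintegral_ge0 => w _; exact: sqr_ge0.
apply: le_trans (bound m).2.
by rewrite le_eqVlt; apply/orP; left; apply/eqP; apply: eq_Rintegral => w _;
  rewrite -sqrrN opprB.
Qed.

Lemma cvg0_of_sqr_le (u v : nat -> R) :
  (forall m, u m ^+ 2 <= v m) -> v m @[m --> \oo] --> 0 -> u m @[m --> \oo] --> 0.
Proof.
move=> uv v0; apply/cvgr0Pnorm_lt => e e0.
have e20 : 0 < e ^+ 2 by rewrite exprn_gt0.
move/cvgr0Pnorm_lt : v0 => /(_ _ e20) [N _ hN]; exists N => // m /hN /= vm.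
rewrite -(ltr_pXn2r (n := 2))// ?nnegrE ?(ltW e0)// real_normK ?num_real//.
by apply: le_lt_trans (uv m) _; apply: le_lt_trans vm; exact: ler_norm.
Qed.

Lemma cvg_mean_mul (f h : nat -> T -> R) (g k : T -> R) :
  (forall m, square_integrable P (f m)) -> (forall m, square_integrable P (h m)) ->
  square_integrable P g -> square_integrable P k ->
  \int[P]_w (f m w - g w) ^+ 2 @[m --> \oo] --> 0 ->
  \int[P]_w (h m w - k w) ^+ 2 @[m --> \oo] --> 0 ->
  \int[P]_w (f m w * h m w) @[m --> \oo] --> \int[P]_w (g w * k w).
Proof.
move=> sf sh sg sk fg hk.
have sfg m := square_integrableB (sf m) sg; have shk m := square_integrableB (sh m) sk.
have i1 m := square_integrable_mul (sfg m) (shk m).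
have i2 m := square_integrable_mul (sfg m) sk.
have i3 m := square_integrable_mul sg (shk m).
have i4 := square_integrable_mul sg sk.
have E m : \int[P]_w (f m w * h m w) =
    \int[P]_w ((f m w - g w) * (h m w - k w)) +
    (\int[P]_w ((f m w - g w) * k w) +
    (\int[P]_w (g w * (h m w - k w)) + \int[P]_w (g w * k w))).
  have i34 := integrableD_real (i3 m) i4.
  have i234 := integrableD_real (i2 m) i34.
  rewrite -(RintegralD measurableT (i3 m) i4) -(RintegralD measurableT (i2 m) i34).
  rewrite -(RintegralD measurableT (i1 m) i234).
  by apply: eq_Rintegral => w _; ring.
rewrite (eq_cvg _ _ E).
have lim1 : \int[P]_w ((f m w - g w) * (h m w - k w)) @[m --> \oo] --> 0.
  apply: cvg0_of_sqr_le => [m|]; first exact: (mean_mul_sqr_le (sfg m) (shk m)).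
  by rewrite -(mulr0 0); exact: cvgM.
have lim2 : \int[P]_w ((f m w - g w) * k w) @[m --> \oo] --> 0.
  apply: cvg0_of_sqr_le => [m|]; first exact: (mean_mul_sqr_le (sfg m) sk).
  by rewrite -(mul0r (\int[P]_w k w ^+ 2)); apply: cvgM => //; exact: cvg_cst.
have lim3 : \int[P]_w (g w * (h m w - k w)) @[m --> \oo] --> 0.
  apply: cvg0_of_sqr_le => [m|]; first exact: (mean_mul_sqr_le sg (shk m)).
  by rewrite -(mulr0 (\int[P]_w g w ^+ 2)); apply: cvgM => //; exact: cvg_cst.
have := cvgD lim1 (cvgD lim2 (cvgD lim3 (cvg_cst (\int[P]_w (g w * k w))))).
by rewrite !add0r; exact.
Qed.

Lemma cvg_mean (f : nat -> T -> R) (g : T -> R) :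
  (forall m, square_integrable P (f m)) -> square_integrable P g ->
  \int[P]_w (f m w - g w) ^+ 2 @[m --> \oo] --> 0 ->
  \int[P]_w f m w @[m --> \oo] --> \int[P]_w g w.
Proof.
move=> sf sg fg; have s1 := square_integrable_cst P 1.
have Z : \int[P]_w (1 - 1) ^+ 2 @[m --> \oo] --> (0 : R).
  have -> : \int[P]_w (1 - 1) ^+ 2 = 0 :> R by rewrite subrr expr0n mean_cst.
  exact: cvg_cst.
have := @cvg_mean_mul f (fun _ _ => 1) g (fun=> 1) sf (fun=> s1) sg s1 fg Z.
have E h : \int[P]_w (h w * 1) = \int[P]_w h w.
  by apply: eq_Rintegral => w _; rewrite mulr1.
by rewrite E; under eq_fun do rewrite E.
Qed.

End mean_square_limit.

(** * Optional stopping *)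

(** A sum over a coarse grid becomes a sum over a finer one with an integrand constant on blocks, so
    that sums over two dyadic grids can be subtracted term by term. *)
Lemma sum_blocks (R : comNzRingType) (J : nat -> R) (b : nat -> R) (N r : nat) : (0 < r)%N ->
  \sum_(j < N * r) J (j %/ r)%N * (b j.+1 - b j) =
  \sum_(k < N) J k * (b (k.+1 * r)%N - b (k * r)%N).
Proof.
move=> r0; elim: N => [|N IH]; first by rewrite mul0n !big_ord0.
rewrite big_ord_recr/= -IH -!(big_mkord xpredT (fun j => J (j %/ r)%N * (b j.+1 - b j))).
rewrite (@big_cat_nat _ _ _ (N * r)%N)//=; last by rewrite leq_mul2r leqnSn orbT.
congr (_ + _).
rewrite (eq_big_nat _ _ (F2 := fun j => J N * (b j.+1 - b j))).
  by rewrite -mulr_sumr telescope_sumr// leq_mul2r leqnSn orbT.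
move=> j /andP[j1 j2]; congr (J _ * _).
rewrite -(subnKC j1) divnMDl// divn_small ?addn0//.
by rewrite ltn_subLR// mulSn addnC in j2 *.
Qed.

(** The sum telescopes up to the first grid point at or after [x], or up to the end of the grid if
    [x] is not reached. *)
Lemma grid_stop (R : realDomainType) (b : R -> R) (t : nat -> R) (h x : R) N :
  0 <= h -> (forall k, t k.+1 = t k + h) -> t 0%N < x ->
  exists2 s, \sum_(k < N) (t k < x)%R%:R * (b (t k.+1) - b (t k)) = b s - b (t 0%N) &
    if t N < x then s = t N else x <= s <= x + h.
Proof.
move=> h0 tS t0x; elim: N => [|N [s sE sN]].
  by exists (t 0%N); [rewrite big_ord0 subrr|rewrite t0x].
rewrite big_ord_recr/= sE; case: ifPn sN => [tN sN|tN sN].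
  exists (t N.+1); first by rewrite sN mul1r addrC subrKA.
  by case: ifPn => // tN1; rewrite leNgt tN1/= tS lerD2r ltW.
exists s; first by rewrite mul0r addr0.
have xtN : x <= t N by rewrite leNgt.
by rewrite ifF//; apply/negbTE; rewrite -leNgt tS (le_trans xtN)// lerDl.
Qed.

Lemma within_continuous_cvg (R : realType) (b : R -> R) (s : nat -> R) (x : R) :
  {within `[0, +oo[, continuous b} -> 0 <= x -> (forall m, 0 <= s m) ->
  s m @[m --> \oo] --> x -> b (s m) @[m --> \oo] --> b x.
Proof.
move=> /subspace_continuousP bc x0 s0 sx.
have := bc x; rewrite /= in_itv/= x0 => /(_ isT) bx.
apply: cvg_trans bx => U /= hU; have := sx _ hU => -[N _ hN].
by exists N => // m /hN /=; apply; rewrite in_itv/= s0.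
Qed.

Section bounded_optional_stopping.
Context {d : measure_display} {T : measurableType d} {R : realType}.
Variables (P : probability T R) (n : nat) (B : 'I_n -> R -> {RV P >-> R}).

(** Phrased by the complements of the events tau <= s, because these indicate that the increment
    after [s] still counts and hence serve as predictable integrands. *)
Definition stopping_time (tau : T -> R) :=
  (forall w, 0 <= tau w) /\
  forall s, 0 <= s -> history B (past s) [set w | s < tau w].

Lemma stopping_time_measurable tau : stopping_time tau -> measurable_fun setT tau.
Proof.
move=> [tau0 htau]; apply: (measurability _ (RGenOInfty.measurableE R)).
move=> _ [_ [s ->] <-]; rewrite setTI.
have [s0|s0] := leP 0 s.
  rewrite (_ : _ @^-1` _ = [set w | s < tau w]).
    by apply: history_measurable; exact: htau.
  by apply/seteqP; split => w /=; rewrite in_itv/= andbT.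
rewrite (_ : _ @^-1` _ = setT); first exact: measurableT.
apply/seteqP; split => w //= _; rewrite in_itv/= andbT.
exact: lt_le_trans s0 (tau0 w).
Qed.

Hypothesis B_brownian : forall i, standard_brownian_motion (B i).
Hypothesis B_independent : independent_processes B.
Variables (u K : R) (tau : T -> R) (A : set T).
Hypotheses (u0 : 0 <= u) (uK : u < K).
Hypotheses (tau_stop : stopping_time tau) (tauK : forall w, tau w <= K).
Hypotheses (hA : history B (past u) A) (Atau : forall w, A w -> u < tau w).

(** Dyadic meshes of [u, K]: every grid refines the earlier ones, which the Cauchy estimate
    exploits. *)
Let h m := (K - u) / 2 ^+ m.
Let t m k := u + k%:R * h m.
Let I m k w : R := \1_A w * (t m k < tau w)%R%:R.

Let h_gt0 m : 0 < h m.
Proof. by rewrite divr_gt0 ?subr_gt0// exprn_gt0. Qed.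

Let t_S m k : t m k.+1 = t m k + h m.
Proof. by rewrite /t -natr1 mulrDl mul1r addrA. Qed.

Let t_0 m : t m 0%N = u. Proof. by rewrite /t mul0r addr0. Qed.

Let t_end m : t m (2 ^ m)%N = K.
Proof. by rewrite /t /h natrX mulrC divfK ?expf_neq0// subrKC. Qed.

Let t_lt m k : t m k < t m k.+1. Proof. by rewrite t_S ltrDl. Qed.

Let t_geu m k : u <= t m k.
Proof. by rewrite /t lerDl mulr_ge0// ltW. Qed.

Let t_fine m l k : t (m + l)%N (k * 2 ^ l)%N = t m k.
Proof.
rewrite /t /h natrM natrX exprD; congr (u + _); field.
by rewrite !expf_neq0.
Qed.

Let t_mono m j k : (j <= k)%N -> t m j <= t m k.
Proof. by move=> jk; rewrite /t lerD2l ler_wpM2r ?ler_nat// ltW. Qed.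

Let stop_indic s : (fun w => (s < tau w)%R%:R) = \1_[set w | s < tau w] :> (T -> R).
Proof.
by apply/funext => w; rewrite indicE; congr (nat_of_bool _)%:R; apply/idP/idP; rewrite inE.
Qed.

(** The coarse integrand read on a finer grid: a block starts no later than each of its points, so
    the integrand only uses the past. *)
Let I_predictable m l : predictable B (t (m + l)%N) (fun j => I m (j %/ 2 ^ l)%N).
Proof.
move=> j; split; last first.
  move=> w; rewrite /I indicE -natrM ger0_norm// lern1.
  by case: (w \in A); case: (_ < _).
have le_t : t m (j %/ 2 ^ l)%N <= t (m + l)%N j.
  by rewrite -(t_fine m l) t_mono// leq_trunc_div.
apply: measurable_funM.
  apply: sub_adapted (adapted_indic hA); apply: sub_past.
  exact: t_geu.
rewrite stop_indic; apply: sub_adapted (adapted_indic (tau_stop.2 _ _)).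
  exact: sub_past.
exact: le_trans u0 (t_geu _ _).
Qed.

Let I_predictable0 m : predictable B (t m) (I m).
Proof.
have := @I_predictable m 0; rewrite addn0.
by under eq_fun do rewrite expn0 divn1.
Qed.

(** On [A] this is the increment of [B i] from [u] to a time at most [h m] after [tau]; off [A] it
    is 0. *)
Let f i m := transform B i (t m) (I m) (2 ^ m).

Let f_fine i m l : f i m = transform B i (t (m + l)%N) (fun j => I m (j %/ 2 ^ l)%N) (2 ^ (m + l)).
Proof.
apply/funext => w; rewrite /f /transform expnD.
rewrite (@sum_blocks _ (fun k => I m k w) (fun j => B i (t (m + l)%N j) w)) ?expn_gt0//.
by apply: eq_bigr => k _; rewrite !t_fine.
Qed.

Let f_stop (b : R -> R) m w : A w ->
  exists2 s, \sum_(k < 2 ^ m) I m k w * (b (t m k.+1) - b (t m k)) = b s - b u &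
    tau w <= s <= tau w + h m.
Proof.
move=> Aw; have tm0 : t m 0%N < tau w by rewrite t_0; exact: Atau.
have [s sE] := grid_stop b (2 ^ m)%N (ltW (h_gt0 m)) (t_S m) tm0.
case: ifPn => [|_ sb]; first by rewrite t_end ltNge tauK.
exists s => //; rewrite -(t_0 m) -sE.
  by apply: eq_bigr => k _; rewrite /I indicE mem_set// mul1r.
Qed.

Let f_out (b : R -> R) m w : ~ A w ->
  \sum_(k < 2 ^ m) I m k w * (b (t m k.+1) - b (t m k)) = 0.
Proof.
by move=> Aw; apply: big1 => k _; rewrite /I indicE memNset// !mul0r.
Qed.

(** The same sum with the identity in place of the path: the time that the isometry charges to
    [f i m], equal to tau - u on [A] up to [h m]. *)
Let S m w := \sum_(k < 2 ^ m) I m k w * (t m k.+1 - t m k).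

Let S_bounds m w : \1_A w * (tau w - u) <= S m w <= \1_A w * (tau w - u) + h m.
Proof.
have [Aw|Aw] := pselect (A w).
  have [s sE] := f_stop id m Aw; rewrite /S sE indicE mem_set// mul1r.
  by move=> /andP[s1 s2]; rewrite lerD2r s1/= addrAC lerD2r.
by rewrite /S (f_out id m Aw) indicE memNset// mul0r add0r lexx ltW.
Qed.

Let f_square_integrable i m : square_integrable P (f i m).
Proof. by apply: transform_square_integrable => //; rewrite t_0. Qed.

Let I_integrable m k : P.-integrable setT (EFin \o I m k).
Proof.
apply: (@le_integrable_real _ _ _ _ _ (fun=> 1)).
- exact: predictable_measurable (I_predictable0 m).
- exact: integrable_cst_real.
- exact: (I_predictable0 m k).2.
Qed.

Let II m k w : I m k w * I m k w = I m k w.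
Proof. by rewrite /I indicE; case: (_ \in _); case: (_ < _); rewrite ?(mulr1, mul0r, mulr0). Qed.

Let S_integrable m : P.-integrable setT (EFin \o S m) /\
  \int[P]_w S m w = \sum_(k < 2 ^ m) (t m k.+1 - t m k) * \int[P]_w I m k w.
Proof.
have i1 k : P.-integrable setT (EFin \o (fun w => I m k w * (t m k.+1 - t m k))).
  have := integrableZ_real (t m k.+1 - t m k) (I_integrable m k).
  by apply: eq_integrable => // w _ /=; rewrite mulrC.
have [i2 e2] := @mean_sum _ _ _ P _ (index_enum 'I_(2 ^ m)) _ (fun k => i1 k).
split => //; rewrite /S e2; apply: eq_bigr => k _.
by rewrite -RintegralZl//; apply: eq_Rintegral => w _; rewrite mulrC.
Qed.

Let f_covariance i j m :
  \int[P]_w (f i m w * f j m w) = (i == j)%:R * \int[P]_w S m w.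
Proof.
rewrite transform_covariance ?t_0// (S_integrable m).2; congr (_ * _).
apply: eq_bigr => k _; congr (_ * _).
by apply: eq_Rintegral => w _; exact: II.
Qed.

(** The difference is a transform on the finer grid, and by the isometry its mean square is the mean
    of the difference of the two sums [S], both of which lie within [h m] above the same value. *)
Let f_cauchy i m l : (m <= l)%N -> \int[P]_w (f i l w - f i m w) ^+ 2 <= h m.
Proof.
move=> ml; rewrite -(subnKC ml); move: (l - m)%N => r {l ml}.
pose J j := fun w => I (m + r)%N j w - I m (j %/ 2 ^ r)%N w.
have le_t j : t m (j %/ 2 ^ r)%N <= t (m + r)%N j.
  by rewrite -(t_fine m r) t_mono// leq_trunc_div.
have le_I j w : I (m + r)%N j w <= I m (j %/ 2 ^ r)%N w.
  rewrite /I ler_wpM2l ?indicE// ler_nat.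
  by case: (ltP (t (m + r)%N j)) => // /(le_lt_trans (le_t j)) ->.
have hJ : predictable B (t (m + r)%N) J.
  move=> j; split.
    exact: (measurable_funB (I_predictable0 (m + r)%N j).1 (I_predictable m r j).1).
  move=> w; rewrite distrC ger0_norm ?subr_ge0//.
  rewrite lerBlDr (le_trans (ler_norm _))// (le_trans ((I_predictable m r j).2 w))//.
  by rewrite lerDl /I mulr_ge0 ?indicE.
have -> : \int[P]_w (f i (m + r)%N w - f i m w) ^+ 2 =
    \int[P]_w (transform B i (t (m + r)%N) J (2 ^ (m + r)) w *
               transform B i (t (m + r)%N) J (2 ^ (m + r)) w).
  apply: eq_Rintegral => w _; rewrite (f_fine i m r) -expr2; congr (_ ^+ 2).
  by rewrite /f /transform -sumrB; apply: eq_bigr => k _; rewrite /J mulrBl.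
rewrite transform_covariance ?t_0// eqxx mul1r.
have iI j : P.-integrable setT (EFin \o (fun w => I m (j %/ 2 ^ r)%N w)) by [].
have iJ j : P.-integrable setT (EFin \o (fun w => J j w * J j w)).
  apply: (@le_integrable_real _ _ _ _ _ (fun=> 1)).
  - by apply: measurable_funM; exact: predictable_measurable hJ.
  - exact: integrable_cst_real.
  - move=> w; rewrite normrM -(mulr1 1).
    by rewrite ler_pM//; exact: (hJ j).2.
have iJ' j : P.-integrable setT
    (EFin \o (fun w => (t (m + r)%N j.+1 - t (m + r)%N j) * (J j w * J j w))).
  exact: integrableZ_real.
have [i2 e2] := @mean_sum _ _ _ P _ (index_enum 'I_(2 ^ (m + r))) _ (fun k => iJ' k).
have -> : \sum_(k < 2 ^ (m + r)) (t (m + r)%N k.+1 - t (m + r)%N k) * \int[P]_w (J k w * J k w) =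
   \int[P]_w (\sum_(k < 2 ^ (m + r)) (t (m + r)%N k.+1 - t (m + r)%N k) * (J k w * J k w)).
  by rewrite e2; apply: eq_bigr => k _; rewrite RintegralZl.
rewrite -[leRHS](mean_cst P); apply: le_Rintegral => //; first exact: integrable_cst_real.
move=> w _.
have -> : \sum_(k < 2 ^ (m + r)) (t (m + r)%N k.+1 - t (m + r)%N k) * (J k w * J k w) =
    S m w - S (m + r)%N w.
  have -> : S m w = \sum_(j < 2 ^ (m + r)) I m (j %/ 2 ^ r)%N w * (t (m + r)%N j.+1 - t (m + r)%N j).
    rewrite expnD (@sum_blocks _ (fun k => I m k w) (fun j => t (m + r)%N j)) ?expn_gt0//.
    by apply: eq_bigr => k _; rewrite !t_fine.
  (* The indicators are nested, so [J] is 0 or -1 and its square is the coarse indicator minus the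
     fine one. *)
  rewrite -sumrB; apply: eq_bigr => k _; rewrite -mulrBl mulrC; congr (_ * _).
  have := le_I k w; rewrite /J /I !indicE.
  by case: (_ \in _); case: (_ < _); case: (_ < _) => /=;
    rewrite ?(mulr1n, mulr0n, mul1r, mul0r, mulr1, mulr0, subrr, subr0, sub0r, mulrNN) ?ler10.
have /andP[a1 a2] := S_bounds m w; have /andP[a3 a4] := S_bounds (m + r)%N w.
by rewrite lerBlDr (le_trans a2)// addrC lerD2l.
Qed.

Let h_cvg0 : h m @[m --> \oo] --> 0.
Proof.
have -> : h = geometric (K - u) 2^-1.
  by apply/funext => m; rewrite /geometric /= /h exprVn.
by apply: cvg_geometric; rewrite ger0_norm ?invr_ge0// invf_lt1// ltr1n.
Qed.

Let g i w := \1_A w * (B i (tau w) w - B i u w).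

Let f_cvg i w : f i m w @[m --> \oo] --> g i w.
Proof.
rewrite /g; have [Aw|Aw] := pselect (A w); last first.
  rewrite indicE memNset// mul0r (_ : (fun m => _) = fun=> 0); first exact: cvg_cst.
  by apply/funext => m; exact: (f_out (fun s => B i s w) m Aw).
rewrite indicE mem_set// mul1r.
have /choice [s hs] : forall m, exists s, f i m w = B i s w - B i u w /\
    tau w <= s <= tau w + h m.
  by move=> m; have [s s1 s2] := f_stop (fun s => B i s w) m Aw; exists s.
rewrite (_ : (fun m => _) = fun m => B i (s m) w - B i u w); last first.
  by apply/funext => m; exact: (hs m).1.
apply: cvgB; last exact: cvg_cst.
have s_cvg : s m @[m --> \oo] --> tau w.
  apply: (@squeeze_cvgr _ _ _ _ (fun=> tau w) (fun m => tau w + h m)).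
  - by apply: nearW => m; exact: (hs m).2.
  - exact: cvg_cst.
  - by rewrite -[X in _ --> X]addr0; apply: cvgD => //; exact: cvg_cst.
apply: (@within_continuous_cvg _ (fun s => B i s w)) s_cvg.
- exact: (bm_continuous (B_brownian i)).
- exact: tau_stop.1.
- by move=> m; rewrite (le_trans (tau_stop.1 w))//; have [_ /andP[]] := hs m.
Qed.

Let g_measurable i : measurable_fun setT (g i).
Proof.
apply: (@measurable_fun_cvg _ _ _ _ (f i)) => [m|w _]; last exact: f_cvg.
exact: (f_square_integrable i m).1.
Qed.

Let g_limit i : square_integrable P (g i) /\
  \int[P]_w (f i m w - g i w) ^+ 2 @[m --> \oo] --> 0.
Proof.
apply: (@mean_square_limit _ _ _ P setT (f i) (g i) h) => //.
- by rewrite setCT measure0.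
- by move=> m k mk; exact: f_cauchy.
Qed.

Lemma stopped_square_integrable i :
  square_integrable P (fun w => \1_A w * (B i (tau w) w - B i u w)).
Proof. exact: (g_limit i).1. Qed.

Lemma stopped_mean i : \int[P]_w (\1_A w * (B i (tau w) w - B i u w)) = 0.
Proof.
have [sg fg] := g_limit i.
have := cvg_mean (f_square_integrable i) sg fg.
have -> : (fun m => \int[P]_w f i m w) = fun=> 0.
  by apply/funext => m; apply: transform_mean => //; rewrite t_0.
by move/(cvg_lim (@Rhausdorff R)) <-; rewrite lim_cst.
Qed.

Lemma stopped_time_integrable :
  P.-integrable setT (EFin \o (fun w => \1_A w * (tau w - u))).
Proof.
apply: (@le_integrable_real _ _ _ _ _ (fun=> K - u)).
- apply: measurable_funM.
    by apply: measurable_indic; apply: history_measurable hA.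
  by apply: measurable_funB => //; exact: stopping_time_measurable.
- exact: integrable_cst_real.
- move=> w; rewrite indicE; have [Aw|Aw] := pselect (A w).
    by rewrite mem_set// mul1r gtr0_norm ?subr_gt0 ?Atau// lerD2r.
  by rewrite memNset// mul0r normr0 subr_ge0 ltW.
Qed.

Lemma stopped_covariance i j :
  \int[P]_w ((\1_A w * (B i (tau w) w - B i u w)) *
             (\1_A w * (B j (tau w) w - B j u w))) =
  (i == j)%:R * \int[P]_w (\1_A w * (tau w - u)).
Proof.
have [sgi fgi] := g_limit i; have [sgj fgj] := g_limit j.
have := cvg_mean_mul (f_square_integrable i) (f_square_integrable j) sgi sgj fgi fgj.
rewrite (eq_cvg _ _ (f_covariance i j)) => /(cvg_lim (@Rhausdorff R)) <-.
have it := stopped_time_integrable.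
apply/(cvg_lim (@Rhausdorff R)); apply: cvgM; first exact: cvg_cst.
set c := \int[P]_w _.
apply: (@squeeze_cvgr _ _ _ _ (fun=> c) (fun m => c + h m)).
- apply: nearW => m; have [iS _] := S_integrable m; apply/andP; split.
    by apply: le_Rintegral => // w _; have /andP[] := S_bounds m w.
  rewrite -(mean_cst P (h m)) /c -RintegralD//; last exact: integrable_cst_real.
  apply: le_Rintegral => //.
    by apply: integrableD_real => //; exact: integrable_cst_real.
  by move=> w _; have /andP[] := S_bounds m w.
- exact: cvg_cst.
- have := cvgD (cvg_cst c) h_cvg0; rewrite addr0; exact.
Qed.

End bounded_optional_stopping.

(** * Stopping times with finite mean, by truncation *)

Section optional_stopping.
Context {d : measure_display} {T : measurableType d} {R : realType}.
Variables (P : probability T R) (n : nat) (B : 'I_n -> R -> {RV P >-> R}).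

Definition truncated_time (tau : T -> \bar R) (K : R) (w : T) : R :=
  fine (Order.min (tau w) K%:E).

Section truncated_time.
Variables (tau : T -> \bar R) (K : R).
Hypotheses (tau0 : forall w, (0 <= tau w)%E) (K0 : 0 <= K).

Lemma truncated_timeE w : (truncated_time tau K w)%:E = Order.min (tau w) K%:E.
Proof.
rewrite /truncated_time fineK// ge0_fin_numE ?le_min ?tau0//=.
  by rewrite gt_min ltry orbT.
Qed.

Lemma lt_truncated_time s w :
  (s < truncated_time tau K w) = (s%:E < tau w)%E && (s < K).
Proof. by rewrite -lte_fin truncated_timeE lt_min lte_fin. Qed.

Lemma truncated_time_ge0 w : 0 <= truncated_time tau K w.
Proof. by rewrite -lee_fin truncated_timeE le_min tau0. Qed.

Lemma truncated_time_le w : truncated_time tau K w <= K.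
Proof. by rewrite -lee_fin truncated_timeE ge_min lexx orbT. Qed.

Lemma truncated_time_le_time w : ((truncated_time tau K w)%:E <= tau w)%E.
Proof. by rewrite truncated_timeE ge_min lexx. Qed.

Lemma truncated_time_id w : (tau w <= K%:E)%E -> truncated_time tau K w = fine (tau w).
Proof. by move=> tK; rewrite /truncated_time min_l. Qed.

Lemma truncated_time_cst w : (K%:E <= tau w)%E -> truncated_time tau K w = K.
Proof. by move=> tK; rewrite /truncated_time min_r. Qed.

End truncated_time.

Lemma truncated_time_cvg (tau : T -> \bar R) (u : R) w : 0 <= u -> (0 <= tau w)%E ->
  ((truncated_time tau (u + m%:R) w)%:E @[m --> \oo] --> tau w)%E.
Proof.
move=> u0 t0; rewrite /truncated_time.
case: (tau w) t0 => [r|_|//].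
  move=> r0; apply: cvg_near_cst; exists (Num.trunc r).+1 => // m /= rm.
  rewrite min_l// lee_fin (le_trans (ltW (truncnS_gt r)))//.
  by rewrite (@le_trans _ _ m%:R) ?ler_nat ?lerDr.
under eq_fun do rewrite min_r ?leey//=.
apply/cvgeryP/cvgryPge => r; exists (Num.trunc r).+1 => // m /= rm.
rewrite (le_trans (ltW (truncnS_gt r)))//.
by rewrite (@le_trans _ _ m%:R) ?ler_nat ?lerDr.
Qed.

Definition extended_stopping_time (tau : T -> \bar R) :=
  (forall w, (0 <= tau w)%E) /\
  forall s, 0 <= s -> history B (past s) [set w | (s%:E < tau w)%E].

Lemma truncated_stopping_time tau K : extended_stopping_time tau -> 0 <= K ->
  stopping_time B (truncated_time tau K).
Proof.
move=> [t0 ht] K0; split => [w|s s0]; first exact: truncated_time_ge0.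
have [sK|Ks] := ltP s K.
  rewrite (_ : [set w | _] = [set w | (s%:E < tau w)%E]); first exact: ht.
  by apply/seteqP; split => w /=; rewrite lt_truncated_time// sK andbT.
rewrite (_ : [set w | _] = set0).
  exact: (@measurable0 _ (g_sigma_algebraType (history_gen B (past s)))).
apply/seteqP; split => w //=; rewrite lt_truncated_time// => /andP[_].
by rewrite ltNge Ks.
Qed.

Hypothesis B_brownian : forall i, standard_brownian_motion (B i).
Hypothesis B_independent : independent_processes B.
Variable tau : T -> \bar R.
Hypothesis tau_stop : extended_stopping_time tau.
Hypothesis tau_int : P.-integrable setT tau.

Let tau0 w : (0 <= tau w)%E. Proof. exact: tau_stop.1. Qed.
Let mtau : measurable_fun setT tau. Proof. exact: measurable_int tau_int. Qed.

Let tr K := truncated_time tau K.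

Let tr_stop K : 0 <= K -> stopping_time B (tr K).
Proof. exact: truncated_stopping_time. Qed.

Let Dfin : set T := [set w | (tau w < +oo)%E].

Let mDfin : measurable Dfin.
Proof.
rewrite (_ : Dfin = setT `&` [set w | (tau w < cst +oo%E w)%E]).
  exact: measurable_lte.
by rewrite setTI.
Qed.

Let PDfin : P (~` Dfin) = 0%E.
Proof.
have /negligibleP := integrable_ae measurableT tau_int.
rewrite (_ : ~` [set x | _] = ~` Dfin).
  by apply; exact: measurableC.
congr (~` _); apply/seteqP; split => w /=.
  by move=> /(_ I); rewrite ge0_fin_numE.
by rewrite /Dfin/= => h _; rewrite ge0_fin_numE.
Qed.

Lemma stopping_time_fin_integrable : P.-integrable setT (EFin \o (fun w => fine (tau w))).
Proof.
have mf : measurable_fun setT (fun w => fine (tau w)) by exact: measurableT_comp.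
apply: le_integrable tau_int => //; first exact/measurable_EFinP.
move=> w _ /=; rewrite ger0_norm ?fine_ge0// gee0_abs//.
by have := tau0 w; case: (tau w) => //= r; rewrite ?leey.
Qed.

Lemma stopping_time_ae : ae_eq P setT tau (fun w => (fine (tau w))%:E).
Proof.
apply: filterS (integrable_ae measurableT tau_int) => w h _.
by rewrite fineK//; exact: h.
Qed.

Lemma mean_stopping_time : (\int[P]_w tau w = (\int[P]_w fine (tau w))%:E)%E.
Proof.
have ifin := stopping_time_fin_integrable.
rewrite (ae_eq_integral _ _ measurableT mtau (measurable_int _ ifin) stopping_time_ae).
by rewrite /Rintegral fineK// integrable_fin_num.
Qed.

Let tr_integrable K : 0 <= K -> P.-integrable setT (EFin \o tr K).
Proof.
move=> K0; apply: le_integrable tau_int => //.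
  by apply/measurable_EFinP; exact: stopping_time_measurable (tr_stop K0).
move=> w _ /=; rewrite ger0_norm ?truncated_time_ge0// gee0_abs//.
exact: truncated_time_le_time.
Qed.

Let tr_mean_cvg u : 0 <= u ->
  \int[P]_w tr (u + m%:R) w @[m --> \oo] --> \int[P]_w fine (tau w).
Proof.
move=> u0; apply: fine_cvg.
rewrite fineK; last first.
  by apply: integrable_fin_num => //; exact: stopping_time_fin_integrable.
have := mean_stopping_time; rewrite /Rintegral fineK; last first.
  by apply: integrable_fin_num => //; exact: stopping_time_fin_integrable.
move=> <-.
have um m : 0 <= u + m%:R by rewrite addr_ge0.
under [X in _ --> X]eq_integral => w _.
  rewrite -(cvg_lim (@ereal_hausdorff R) (truncated_time_cvg u0 (tau0 w))); over.
apply: cvg_monotone_convergence => //.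
- by move=> m; apply: measurable_int (tr_integrable (um m)).
- by move=> m w _; rewrite lee_fin truncated_time_ge0.
- move=> w _ m k mk; rewrite !truncated_timeE//.
  by rewrite le_min ge_min lexx/= ge_min lee_fin lerD2l ler_nat mk orbT.
Qed.

Section at_time.
Variables (u : R) (A : set T).
Hypotheses (u0 : 0 <= u) (hA : history B (past u) A).
Hypothesis Atau : forall w, A w -> (u%:E < tau w)%E.

(** The summand 1 keeps every level strictly above [u], as the bounded case demands. *)
Let K m := (u + 1) + m%:R.
Let uK m : u < K m. Proof. by rewrite /K -addrA ltrDl ltr_wpDr. Qed.
Let K0 m : 0 <= K m. Proof. exact: le_trans u0 (ltW (uK m)). Qed.

Let f i m w := \1_A w * (B i (tr (K m) w) w - B i u w).
Let g i w := \1_A w * (B i (fine (tau w)) w - B i u w).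

Let AK m w : A w -> u < tr (K m) w.
Proof. by move=> Aw; rewrite lt_truncated_time// Atau// uK. Qed.

Let sf i m : square_integrable P (f i m).
Proof.
apply: (stopped_square_integrable B_brownian B_independent u0 (uK m)) => //.
- exact: tr_stop.
- by move=> w; exact: truncated_time_le.
- exact: AK.
Qed.

Let f_mean i m : \int[P]_w f i m w = 0.
Proof.
apply: (stopped_mean B_brownian B_independent u0 (uK m)) => //.
- exact: tr_stop.
- by move=> w; exact: truncated_time_le.
- exact: AK.
Qed.

Let f_cov i j m : \int[P]_w (f i m w * f j m w) =
  (i == j)%:R * \int[P]_w (\1_A w * (tr (K m) w - u)).
Proof.
apply: (stopped_covariance B_brownian B_independent u0 (uK m)) => //.
- exact: tr_stop.
- by move=> w; exact: truncated_time_le.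
- exact: AK.
Qed.

Let f_fin i w : Dfin w -> f i m w @[m --> \oo] --> g i w.
Proof.
move=> Dw; apply: cvg_near_cst; exists (Num.trunc (fine (tau w))).+1 => // m /= rm.
rewrite /f /g /tr truncated_time_id//.
rewrite -[tau w]fineK ?ge0_fin_numE// lee_fin.
rewrite (le_trans (ltW (truncnS_gt _)))// (@le_trans _ _ m%:R) ?ler_nat//.
by rewrite /K lerDr addr_ge0.
Qed.

Let e m := \int[P]_w fine (tau w) - \int[P]_w tr (K m) w.

Let e_cvg : e m @[m --> \oo] --> 0.
Proof.
rewrite -(subrr (\int[P]_w fine (tau w))); apply: cvgB; first exact: cvg_cst.
by apply: tr_mean_cvg; rewrite addr_ge0.
Qed.

Let tr_mean_le m : \int[P]_w tr (K m) w <= \int[P]_w fine (tau w).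
Proof.
rewrite -lee_fin -mean_stopping_time /Rintegral fineK; last first.
  by apply: integrable_fin_num => //; exact: tr_integrable.
apply: ge0_le_integral => //.
- by move=> w _; rewrite lee_fin truncated_time_ge0.
- exact: measurable_int (tr_integrable (K0 m)).
- by move=> w _; exact: truncated_time_le_time.
Qed.

(* [f i k - f i m] is the increment of [B i] after [K m] of the motion stopped
   at [tr (K k)], on the event that [tau] is not reached before [K m]. *)
Let f_cauchy i m k : (m <= k)%N -> \int[P]_w (f i k w - f i m w) ^+ 2 <= e m.
Proof.
rewrite leq_eqVlt => /orP[/eqP <-|mk].
  rewrite (_ : \int[P]_w _ = 0) ?subr_ge0//.
  by rewrite -[RHS](mean_cst P); apply: eq_Rintegral => w _; rewrite subrr expr0n.
have Kmk : K m < K k by rewrite ltrD2l ltr_nat.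
(* The bounded isometry is used from time [K m] on this event, which is in the past of [K m]. It
   gives the mean time between the two truncations, at most [e m]. *)
pose A' := A `&` [set w | ((K m)%:E < tau w)%E].
have hA' : history B (past (K m)) A'.
  apply: (@measurableI _ (g_sigma_algebraType (history_gen B (past (K m))))).
    by apply: sub_history hA; apply: sub_past; exact: ltW.
  exact: tau_stop.2.
have A'K w : A' w -> K m < tr (K k) w.
  by move=> [_ h]; rewrite lt_truncated_time// Kmk andbT.
have fA' w : f i k w - f i m w = \1_A' w * (B i (tr (K k) w) w - B i (K m) w).
  have -> : f i k w - f i m w = \1_A w * (B i (tr (K k) w) w - B i (tr (K m) w) w).
    by rewrite /f; ring.
  have [[Aw lt]|nA'w] := pselect (A' w).
    rewrite !indicE !mem_set//; congr (_ * (_ - B i _ w)).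
    by apply: truncated_time_cst; exact: ltW.
  rewrite [in RHS]indicE memNset// mul0r.
  have [Aw|Aw] := pselect (A w); last by rewrite indicE memNset// mul0r.
  have le : (tau w <= (K m)%:E)%E by rewrite leNgt; apply/negP => lt; exact: nA'w.
  rewrite /tr !truncated_time_id ?subrr ?mulr0//.
  by rewrite (le_trans le)// lee_fin ltW.
have trk : forall w, tr (K k) w <= K k by move=> w; exact: truncated_time_le.
have := stopped_covariance B_brownian B_independent (K0 m) Kmk (tr_stop (K0 k)) trk hA' A'K i i.
rewrite eqxx mul1r => cov.
rewrite (_ : \int[P]_w _ = \int[P]_w (\1_A' w * (tr (K k) w - K m))); last first.
  by rewrite -cov; apply: eq_Rintegral => w _; rewrite fA' expr2.
have itk := tr_integrable (K0 k); have itm := tr_integrable (K0 m).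
apply: (@le_trans _ _ (\int[P]_w (tr (K k) w - tr (K m) w))); last first.
  by rewrite RintegralB// lerD2r.
apply: le_Rintegral => //.
- exact: (stopped_time_integrable Kmk (tr_stop (K0 k)) trk hA' A'K).
- exact: integrableB_real.
- move=> w _; rewrite indicE.
  have le_tr : tr (K m) w <= tr (K k) w.
    rewrite -lee_fin !truncated_timeE//.
    by rewrite le_min ge_min lexx/= ge_min lee_fin (ltW Kmk) orbT.
  case: (pselect (A' w)) => A'w.
    by rewrite mem_set// mul1r lerD2l lerN2; exact: truncated_time_le.
  by rewrite memNset// mul0r subr_ge0.
Qed.

Let g_measurable i : measurable_fun setT (g i).
Proof.
have -> : g i = fun w => \1_A w * (B i (fine (tau w)) w) - \1_A w * B i u w.
  by apply/funext => w; rewrite /g mulrBr.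
have mA : measurable_fun setT (\1_A : T -> R).
  by apply: measurable_indic; exact: history_measurable hA.
apply: measurable_funB; last exact: measurable_funM.
(* The functions [f i m] are only known to converge to [g i] on [Dfin]. Off it [fine (tau w)] is 0
   by default and the path starts at 0, so this indicator changes nothing. *)
have E w : \1_A w * B i (fine (tau w)) w = \1_Dfin w * (\1_A w * B i (fine (tau w)) w).
  have [Dw|Dw] := pselect (Dfin w); first by rewrite [\1_Dfin w]indicE mem_set// mul1r.
  rewrite [\1_Dfin w]indicE memNset// mul0r.
  suff -> : fine (tau w) = 0 by rewrite (bm_start (B_brownian i)) mulr0.
  by move: Dw; rewrite /Dfin/=; case: (tau w) (tau0 w) => // r; rewrite ltry.
rewrite (_ : (fun w => _) = fun w => \1_Dfin w * (\1_A w * B i (fine (tau w)) w));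
  last exact/funext.
apply: (@measurable_fun_cvg _ _ _ _
    (fun m w => \1_Dfin w * (f i m w + \1_A w * B i u w))) => [m|w _].
  apply: measurable_funM; first exact: measurable_indic.
  by apply: measurable_funD; [exact: (sf i m).1|exact: measurable_funM].
have [Dw|Dw] := pselect (Dfin w); last first.
  rewrite indicE memNset// mul0r; under eq_fun do rewrite mul0r.
  exact: cvg_cst.
rewrite indicE mem_set// mul1r; under eq_fun do rewrite mul1r.
have -> : \1_A w * B i (fine (tau w)) w = g i w + \1_A w * B i u w.
  by rewrite /g mulrBr subrK.
by apply: cvgD; [exact: f_fin|exact: cvg_cst].
Qed.

Let g_limit i : square_integrable P (g i) /\
  \int[P]_w (f i m w - g i w) ^+ 2 @[m --> \oo] --> 0.
Proof.
apply: (@mean_square_limit _ _ _ P Dfin (f i) (g i) e) => //.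
- exact: f_fin.
- by move=> m k mk; exact: f_cauchy.
Qed.

Lemma optional_stopping_square_integrable i :
  square_integrable P (fun w => \1_A w * (B i (fine (tau w)) w - B i u w)).
Proof. exact: (g_limit i).1. Qed.

Lemma optional_stopping_mean i :
  \int[P]_w (\1_A w * (B i (fine (tau w)) w - B i u w)) = 0.
Proof.
have [sg fg] := g_limit i.
have := cvg_mean (sf i) sg fg; rewrite (eq_cvg _ _ (f_mean i)).
by move/(cvg_lim (@Rhausdorff R)) <-; rewrite lim_cst.
Qed.

Lemma optional_stopping_covariance i j :
  A = setT -> u = 0 ->
  \int[P]_w (g i w * g j w) = (i == j)%:R * \int[P]_w fine (tau w).
Proof.
move=> AT uE; have [sgi fgi] := g_limit i; have [sgj fgj] := g_limit j.
have := cvg_mean_mul (sf i) (sf j) sgi sgj fgi fgj.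
rewrite (eq_cvg _ _ (f_cov i j)) => /(cvg_lim (@Rhausdorff R)) <-.
apply/(cvg_lim (@Rhausdorff R)); apply: cvgM; first exact: cvg_cst.
have E m : \int[P]_w (\1_A w * (tr (K m) w - u)) = \int[P]_w tr (K m) w.
  by apply: eq_Rintegral => w _; rewrite AT indicT mul1r uE subr0.
by rewrite (eq_cvg _ _ E); apply: tr_mean_cvg; rewrite addr_ge0.
Qed.

End at_time.

End optional_stopping.

(** * Area under the stopped paths *)

(** For u >= 0, the largest multiple of 1 / (m + 1) not above [u]: reduces questions about all times
    to countably many. *)
Definition grid {R : realType} (m : nat) (u : R) : R :=
  (Num.trunc (m.+1%:R * u))%:R / m.+1%:R.

Section grid.
Context {R : realType}.
Implicit Types u : R.

Lemma grid_ge0 m u : 0 <= grid m u.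
Proof. by rewrite /grid divr_ge0. Qed.

Lemma grid_le m u : 0 <= u -> grid m u <= u.
Proof.
move=> u0; rewrite /grid ler_pdivrMr// mulrC truncn_le.
by rewrite mulr_ge0.
Qed.

Lemma grid_cvg u : 0 <= u -> grid m u @[m --> \oo] --> u.
Proof.
move=> u0; apply: (@squeeze_cvgr _ _ _ _ (fun m => u - m.+1%:R^-1) (fun=> u)).
- apply: nearW => m; rewrite grid_le// andbT /grid lerBlDr.
  by rewrite -[X in _ + X]mul1r -mulrDl ler_pdivlMr// mulrC natr1 ltW// truncnS_gt.
- have := cvgB (cvg_cst u) (@cvg_harmonic R); rewrite subr0; exact.
- exact: cvg_cst.
Qed.

End grid.

Section path_area.
Context {d : measure_display} {T : measurableType d} {R : realType}.
Variables (P : probability T R) (n : nat) (B : 'I_n -> R -> {RV P >-> R}).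
Hypothesis B_brownian : forall i, standard_brownian_motion (B i).
Hypothesis B_independent : independent_processes B.
Local Notation mu := (@lebesgue_measure R).

Lemma historyT (J : 'I_n -> set R) : history B J setT.
Proof. exact: (@measurableT _ (g_sigma_algebraType (history_gen B J))). Qed.

Lemma path_cvg (i : 'I_n) (w : T) (s : nat -> R) (x : R) : 0 <= x -> (forall m, 0 <= s m) ->
  s m @[m --> \oo] --> x -> (B i (s m) w : R) @[m --> \oo] --> (B i x w : R).
Proof.
move=> x0 s0 sx.
apply: (@within_continuous_cvg _ (fun t => B i t w) s x) => //.
exact: (bm_continuous (B_brownian i)).
Qed.

(** Rounding the time down to a grid makes the preimages countable unions of rectangles, and
    continuity passes to the limit. The maximum with 0 is there because paths are only controlled at
    non-negative times. *)
Lemma path_jointly_measurable i :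
  measurable_fun setT (fun z : T * measurableTypeR R => B i (Num.max z.2 0) z.1).
Proof.
have mmax : measurable_fun setT (fun u : measurableTypeR R => Num.max u 0 : R).
  exact: measurable_maxr.
pose F m (z : T * measurableTypeR R) : R := B i (grid m (Num.max z.2 0)) z.1.
apply: (@measurable_fun_cvg _ _ _ _ F) => [m|z _]; last first.
  by apply: path_cvg; [rewrite le_max lexx orbT|move=> m; exact: grid_ge0|
    apply: grid_cvg; rewrite le_max lexx orbT].
move=> _ C mC; rewrite setTI.
pose U k : set (measurableTypeR R) :=
  [set u | k%:R <= m.+1%:R * Num.max u 0 < k.+1%:R].
rewrite (_ : _ @^-1` _ =
    \bigcup_k ((B i (k%:R / m.+1%:R) @^-1` C) `*` U k)); last first.
  apply/seteqP; split => [[w u]/= h|[w u] [k _ [/= h]]].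
    exists (Num.trunc (m.+1%:R * Num.max u 0)) => //; split => //=.
    by rewrite /U/= truncn_itv// mulr_ge0// le_max lexx orbT.
  by rewrite /U/= => /truncn_def kE; rewrite /F/= /grid kE.
apply: bigcupT_measurable => k; apply: measurableX.
  by rewrite -[X in measurable X]setTI; exact: measurable_funPT.
rewrite (_ : U k = (fun u => m.+1%:R * Num.max u 0) @^-1` `[k%:R, k.+1%:R[).
  by rewrite -[X in measurable X]setTI; exact: measurable_funM.
by apply/seteqP; split => u; rewrite /U/= in_itv.
Qed.

Variable tau : T -> \bar R.
Hypothesis tau_stop : extended_stopping_time B tau.
Hypothesis tau_int : P.-integrable setT tau.
Hypothesis tau_gt0 : forall w, (0 < tau w)%E.

Let tau0 w : (0 <= tau w)%E. Proof. exact: tau_stop.1. Qed.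
Let mtau : measurable_fun setT tau. Proof. exact: measurable_int tau_int. Qed.
Let rt w : R := fine (tau w).
Let ift : P.-integrable setT (EFin \o rt) := stopping_time_fin_integrable tau_stop tau_int.

Let before : set (T * measurableTypeR R) :=
  [set z | 0 <= z.2 /\ (z.2%:E < tau z.1)%E].

Let before_measurable : measurable before.
Proof.
have m2 : measurable_fun setT (fun z : T * measurableTypeR R => z.2 : R).
  exact: measurable_snd.
have m2E : measurable_fun setT (fun z : T * measurableTypeR R => (z.2 : R)%:E).
  exact/measurable_EFinP.
have m1 : measurable_fun setT (fun z : T * measurableTypeR R => tau z.1).
  by apply: measurableT_comp => //; exact: measurable_fst.
rewrite (_ : before = ((fun z : T * measurableTypeR R => z.2 : R) @^-1` `[0, +oo[) `&`
   (setT `&` [set z | (z.2%:E < tau z.1)%E])).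
  apply: measurableI; last exact: measurable_lte.
  by rewrite -[X in measurable X]setTI; exact: m2.
by apply/seteqP; split => z; rewrite setTI /before/= in_itv/= andbT.
Qed.

(** [H] is the running path before [tau]; [H'] below replaces it by its value at [tau]. Integrated
    over time they give the area and tau B_i(tau). *)
Let H i (z : T * measurableTypeR R) : R := \1_before z * B i (Num.max z.2 0) z.1.
Let H' i (z : T * measurableTypeR R) : R := \1_before z * B i (rt z.1) z.1.

Lemma stopped_path_square_integrable i :
  square_integrable P (fun w => B i (rt w) w).
Proof.
have := optional_stopping_square_integrable B_brownian B_independent tau_stop tau_int
  (lexx 0) (@historyT (past 0)) (fun w _ => tau_gt0 w) i.
congr square_integrable; apply/funext => w.
by rewrite indicT mul1r (bm_start (B_brownian i)) subr0.
Qed.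

Lemma stopped_path_covariance i j :
  \int[P]_w (B i (rt w) w * B j (rt w) w) = (i == j)%:R * \int[P]_w rt w.
Proof.
rewrite -(optional_stopping_covariance B_brownian B_independent tau_stop tau_int
  (lexx 0) (@historyT (past 0)) (fun w _ => tau_gt0 w) i j)//.
apply: eq_Rintegral => w _.
by rewrite indicT !mul1r !(bm_start (B_brownian _)) !subr0.
Qed.

Lemma stopped_path_mean i : \int[P]_w B i (rt w) w = 0.
Proof.
rewrite -[RHS](optional_stopping_mean B_brownian B_independent tau_stop tau_int
  (lexx 0) (@historyT (past 0)) (fun w _ => tau_gt0 w) i).
apply: eq_Rintegral => w _.
by rewrite indicT mul1r (bm_start (B_brownian _)) subr0.
Qed.

Let stopped_path_measurable i : measurable_fun setT (fun w => B i (rt w) w).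
Proof. exact: (stopped_path_square_integrable i).1. Qed.

Let mH i : measurable_fun setT (H i).
Proof.
by apply: measurable_funM; [exact: measurable_indic|exact: path_jointly_measurable].
Qed.

Let mH' i : measurable_fun setT (H' i).
Proof.
apply: measurable_funM; first exact: measurable_indic.
apply: (measurableT_comp (stopped_path_measurable i)); exact: measurable_fst.
Qed.

Hypothesis stopped_time_square_integrable : square_integrable P rt.

Let After u : set T := [set w | (u%:E < tau w)%E].

Let H_before i u w : 0 <= u -> H i (w, u) = \1_(After u) w * B i u w.
Proof.
move=> u0; rewrite /H /= max_l//; congr (_ * _); rewrite !indicE; congr (nat_of_bool _)%:R.
by apply/idP/idP; rewrite !inE; [case|].
Qed.

Let H'_before i u w : 0 <= u -> H' i (w, u) = \1_(After u) w * B i (rt w) w.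
Proof.
move=> u0; rewrite /H' /=; congr (_ * _); rewrite !indicE; congr (nat_of_bool _)%:R.
by apply/idP/idP; rewrite !inE; [case|].
Qed.

Let H_neg i u w : u < 0 -> H i (w, u) = 0.
Proof.
move=> u0; rewrite /H indicE memNset ?mul0r// => -[/=].
by rewrite leNgt u0.
Qed.

Let H'_neg i u w : u < 0 -> H' i (w, u) = 0.
Proof.
move=> u0; rewrite /H' indicE memNset ?mul0r// => -[/=].
by rewrite leNgt u0.
Qed.

Let After_history u : 0 <= u -> history B (past u) (After u).
Proof. exact: tau_stop.2. Qed.

Let event_mean i u A : 0 <= u -> history B (past u) A -> A `<=` After u ->
  \int[P]_w (\1_A w * B i u w) = \int[P]_w (\1_A w * B i (rt w) w).
Proof.
move=> u0 hA AA; have mA := history_measurable hA.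
have i1 := square_integrable_integrable (square_integrable_indic mA (path_square_integrable B_brownian i u0)).
have i2 := square_integrable_integrable (square_integrable_indic mA (stopped_path_square_integrable i)).
apply/esym/eqP; rewrite -subr_eq0 -RintegralB//.
rewrite -[X in _ == X](optional_stopping_mean B_brownian B_independent tau_stop tau_int
  u0 hA AA i).
by apply/eqP/eq_Rintegral => w _; rewrite mulrBr.
Qed.

(** A conditional Jensen inequality by hand: on each of the events [A1] and [A2], given by the sign
    of [B i u], the means at [u] and at [tau] agree. It transfers integrability from [H'] to [H]. *)
Let abs_mean_le i u : 0 <= u ->
  (\int[P]_w `|H i (w, u)|%:E <= \int[P]_w `|H' i (w, u)|%:E)%E.
Proof.
move=> u0.
pose A1 := After u `&` B i u @^-1` `[0, +oo[.
pose A2 := After u `&` B i u @^-1` `]-oo, 0[.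
have hB (C : set R) : measurable C -> history B (past u) (After u `&` B i u @^-1` C).
  move=> mC; apply: (@measurableI _ (g_sigma_algebraType (history_gen B (past u)))).
    exact: After_history.
  by apply: adapted_preimage => //; apply: adapted_path; rewrite /past/= in_itv/= u0 lexx.
have h1 : history B (past u) A1 by exact: hB.
have h2 : history B (past u) A2 by exact: hB.
have mA := history_measurable (After_history u0).
have m1 := history_measurable h1; have m2 := history_measurable h2.
have sB := path_square_integrable B_brownian i u0.
have sB' := stopped_path_square_integrable i.
have i1 := square_integrable_integrable (square_integrable_indic m1 sB).
have i2 := square_integrable_integrable (square_integrable_indic m2 sB).
have i1' := square_integrable_integrable (square_integrable_indic m1 sB').
have i2' := square_integrable_integrable (square_integrable_indic m2 sB').
have cases w (x : R) : \1_A1 w * x - \1_A2 w * x =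
    \1_(After u) w * (if 0 <= B i u w then x else - x).
  have [Aw|nAw] := pselect (After u w); last first.
    by rewrite !indicE !memNset ?mul0r ?subrr//; case.
  have [b0|b0] := leP 0 (B i u w).
    rewrite !indicE (mem_set Aw) mem_set; last by split => //=; rewrite in_itv/= b0.
    rewrite memNset ?mul0r ?subr0// => -[_] /=.
    by rewrite in_itv/= ltNge b0.
  rewrite !indicE (mem_set Aw) memNset; last first.
    by move=> [_] /=; rewrite in_itv/= andbT leNgt b0.
  by rewrite mem_set ?mul0r ?sub0r ?mul1r//; split => //=; rewrite in_itv.
have indic_norm w (x : R) : `|\1_(After u) w * x| = \1_(After u) w * `|x|.
  by rewrite normrM indicE [`|_%:R|]ger0_norm.
have split w : `|H i (w, u)| = \1_A1 w * B i u w - \1_A2 w * B i u w.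
  rewrite H_before// cases indic_norm; congr (_ * _).
  by case: leP => b0; [rewrite ger0_norm|rewrite ltr0_norm].
have split' w : \1_A1 w * B i (rt w) w - \1_A2 w * B i (rt w) w <= `|H' i (w, u)|.
  rewrite H'_before// cases indic_norm ler_wpM2l ?indicE//.
  by case: ifP => _; rewrite ?ler_norm// -normrN ler_norm.
have iH : P.-integrable setT (EFin \o (fun w => `|H i (w, u)|)).
  by under eq_fun do rewrite split; exact: integrableB_real.
have iH' : P.-integrable setT (EFin \o (fun w => `|H' i (w, u)|)).
  under eq_fun do rewrite H'_before//.
  apply: integrable_norm.
  exact: square_integrable_integrable (square_integrable_indic mA sB').
rewrite -(@fineK _ (\int[P]_w `|H i (w, u)|%:E)%E); last exact: integrable_fin_num.
rewrite -(@fineK _ (\int[P]_w `|H' i (w, u)|%:E)%E); last exact: integrable_fin_num.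
rewrite lee_fin -!/(Rintegral _ _ _).
rewrite (_ : \int[P]_w `|H i (w, u)| =
    \int[P]_w (\1_A1 w * B i (rt w) w - \1_A2 w * B i (rt w) w)).
  apply: le_Rintegral => //; first exact: integrableB_real.
under eq_Rintegral do rewrite split.
rewrite !RintegralB// !event_mean//; by move=> w [].
Qed.

Let indic_before w u : (tau w < +oo)%E ->
  \1_before (w, u) = \1_(`[0, rt w[%classic : set R) u :> R.
Proof.
move=> wfin; rewrite !indicE; congr (nat_of_bool _)%:R; apply/idP/idP; rewrite !inE /before/=.
  by move=> [u0]; rewrite in_itv/= u0 -lte_fin fineK ?ge0_fin_numE.
by rewrite in_itv/= => /andP[u0 ut]; split => //; rewrite -[tau w]fineK ?ge0_fin_numE.
Qed.

(** The second alternative covers tau = +oo, where the region is a half-line although [rt w] is 0 by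
    default. There B_i(rt) = B_i(0) = 0. *)
Let integral_before w (c : R) : (tau w < +oo)%E \/ c = 0 ->
  (\int[mu]_u (\1_before (w, u) * c)%:E = (rt w * c)%:E)%E.
Proof.
have [wfin _|winf [wfin|->]] := boolP (tau w < +oo)%E; last 2 first.
- by [].
- by rewrite mulr0; under eq_integral do rewrite mulr0; rewrite integral0.
under eq_integral do rewrite indic_before// mulrC EFinM.
rewrite integralZl//; last exact: integrable_indic_itv.
rewrite integral_indic//= setIT lebesgue_measure_itv/= lte_fin.
have rt0 : 0 <= rt w by rewrite fine_ge0.
rewrite oppr0 adde0 mulrC EFinM; congr (_ * _)%E.
by case: ltgtP rt0 => // <-.
Qed.

Let stopped_path_fin i w : (tau w < +oo)%E \/ B i (rt w) w = 0.
Proof.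
rewrite /rt; case: (tau w) (tau0 w) => [r|_|//]; first by left; rewrite ltry.
by right; rewrite /= (bm_start (B_brownian i)).
Qed.

Let mHE i : measurable_fun setT (EFin \o H i). Proof. exact/measurable_EFinP. Qed.
Let mHE' i : measurable_fun setT (EFin \o H' i). Proof. exact/measurable_EFinP. Qed.

Let H'_integrable i : (P \x mu)%E.-integrable setT (EFin \o H' i).
Proof.
apply/integrable12ltyP => //.
have -> : (\int[P]_w \int[mu]_u `|(EFin \o H' i) (w, u)| =
    \int[P]_w (rt w * `|B i (rt w) w|)%:E)%E.
  apply: eq_integral => w _; rewrite -integral_before.
    apply: eq_integral => u _; rewrite /H'/= normrM; congr (_ * _)%:E.
    by rewrite ger0_norm// indicE.
  by case: (stopped_path_fin i w) => [|->]; [left|right; rewrite normr0].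
have sB : square_integrable P (fun w => `|B i (rt w) w|).
  split; first by apply: measurableT_comp.
  have := (stopped_path_square_integrable i).2.
  by apply: eq_integrable => // w _; rewrite real_normK// num_real.
have iB := square_integrable_mul stopped_time_square_integrable sB.
by rewrite -ge0_fin_numE ?integrable_fin_num// integral_ge0// => w _;
  rewrite lee_fin mulr_ge0// fine_ge0.
Qed.

Let H_integrable i : (P \x mu)%E.-integrable setT (EFin \o H i).
Proof.
apply/integrable21ltyP => //.
apply: le_lt_trans ((integrable21ltyP _ _ (mHE' i)).1 (H'_integrable i)).
apply: ge0_le_integral => //.
- by move=> u _; exact: integral_ge0.
- by apply: (measurable_fun_fubini_tonelli_G (abse \o (EFin \o H i))) => //=;
    exact: measurableT_comp.
- by apply: (measurable_fun_fubini_tonelli_G (abse \o (EFin \o H' i))) => //=;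
    exact: measurableT_comp.
- move=> u _; have [u0|u0] := leP 0 u; first exact: abs_mean_le.
  by rewrite le_eqVlt; apply/orP; left; apply/eqP; apply: eq_integral => w _;
    rewrite /= H_neg// H'_neg.
Qed.

Let area i w : R := \int[mu]_(u in `[0, rt w]) B i u w.

Let path_integrable i w (x : R) : mu.-integrable `[0, x] (EFin \o (fun u => B i u w)).
Proof.
apply: continuous_compact_integrable; first exact: segment_compact.
have sub : (`[0, x] : set R) `<=` `[0, +oo[ by move=> u /=; rewrite !in_itv/= => /andP[->].
by apply: (continuous_subspaceW sub); exact: (bm_continuous (B_brownian i)).
Qed.

Let area_before i w : (tau w < +oo)%E ->
  (\int[mu]_u (H i (w, u))%:E = (area i w)%:E)%E.
Proof.
move=> wfin; rewrite /area /Rintegral fineK; last first.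
  by apply: integrable_fin_num => //; exact: path_integrable.
pose J : set R := `[0, rt w[%classic.
have HE u : (H i (w, u))%:E = ((fun u => (B i u w)%:E) \_ J) u.
  rewrite patchE /H indic_before//= indicE; case: ifPn => ut; last by rewrite mul0r.
  rewrite mul1r max_l//.
  by move: ut; rewrite inE /J/= in_itv/= => /andP[].
transitivity (\int[mu]_u ((fun u => (B i u w)%:E) \_ J) u)%E.
  by apply: eq_integral => u _; exact: HE.
rewrite -integral_mkcond integral_itv_bndo_bndc//.
apply: measurable_int (integrableS _ _ _ (path_integrable i w (rt w))) => //.
by move=> u /=; rewrite !in_itv/= => /andP[-> /ltW].
Qed.

(** Gives measurability of the area through the partial integrals of Fubini's theorem. Where tau =
    +oo, the default value shrinks the interval to a point. *)
Let area_fin i w : area i w = \1_[set w | (tau w < +oo)%E] w *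
  fine (fubini_F mu (EFin \o H i) w).
Proof.
have [wfin|winf] := pselect (tau w < +oo)%E.
  by rewrite indicE mem_set// mul1r /fubini_F area_before.
rewrite indicE memNset// mul0r /area /rt.
have -> : tau w = +oo%E by move: winf; case: (tau w) (tau0 w) => // r; rewrite ltry.
by rewrite /= set_itv1 Rintegral_set1.
Qed.

Let fin_measurable : measurable [set w | (tau w < +oo)%E].
Proof.
rewrite (_ : [set w | _] = setT `&` [set w | (tau w < cst +oo%E w)%E]).
  exact: measurable_lte.
by rewrite setTI.
Qed.

Let area_measurable i : measurable_fun setT (area i).
Proof.
rewrite (_ : area i = fun w => \1_[set w | (tau w < +oo)%E] w *
  fine (fubini_F mu (EFin \o H i) w)); last exact/funext/area_fin.
apply: measurable_funM; first exact: measurable_indic.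
by apply: measurableT_comp => //; exact: measurable_fubini_F.
Qed.

Let area_ae i : ae_eq P setT (EFin \o area i) (fubini_F mu (EFin \o H i)).
Proof.
apply: filterS (integrable_ae measurableT tau_int) => w h _.
rewrite /fubini_F /= area_before//.
by rewrite -ge0_fin_numE//; exact: h.
Qed.

Lemma stopped_area i :
  P.-integrable setT (EFin \o (fun w => \int[mu]_(u in `[0, fine (tau w)]) B i u w)) /\
  \int[P]_w (\int[mu]_(u in `[0, fine (tau w)]) B i u w) =
    \int[P]_w (fine (tau w) * B i (fine (tau w)) w).
Proof.
rewrite -/(rt _) -/(area i _).
have iF := integrable_fubini_F (H_integrable i).
have mF := measurable_int _ iF.
have mA : measurable_fun setT (EFin \o area i) by exact/measurable_EFinP.
have iA : P.-integrable setT (EFin \o area i).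
  apply: (le_integrable _ mA _ iF) => // w _.
  have [wfin|winf] := pselect (tau w < +oo)%E; first by rewrite /= /fubini_F area_before.
  by rewrite /= area_fin indicE memNset// mul0r normr0 abse_ge0.
split => //; rewrite /Rintegral; congr fine.
rewrite (ae_eq_integral _ _ measurableT mA mF (area_ae i)).
rewrite (Fubini (H_integrable i)).
(* At each fixed time the means of [H] and [H'] agree, so Fubini is applied once in each
   direction. *)
transitivity (\int[mu]_u \int[P]_w (H' i (w, u))%:E)%E.
  apply: eq_integral => u _; have [u0|u0] := leP 0 u; last first.
    by apply: eq_integral => w _; rewrite /= H_neg// H'_neg.
  have mA1 := history_measurable (After_history u0).
  have i1 := square_integrable_integrable
    (square_integrable_indic mA1 (path_square_integrable B_brownian i u0)).
  have i2 := square_integrable_integrable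
    (square_integrable_indic mA1 (stopped_path_square_integrable i)).
  under eq_integral do rewrite /= H_before//.
  under [RHS]eq_integral do rewrite H'_before//.
  rewrite -[LHS]fineK; last exact: integrable_fin_num.
  rewrite -[RHS]fineK; last exact: integrable_fin_num.
  by congr EFin; apply: (event_mean i u0 (After_history u0)).
rewrite -(Fubini (H'_integrable i)).
by apply: eq_integral => w _; rewrite -integral_before//; exact: stopped_path_fin.
Qed.

End path_area.

(** * Hitting times *)

Section hitting_time.
Context {R : realType}.
Variables (x : R -> R) (Q : R).
Hypotheses (xc : {within `[0, +oo[, continuous x}) (x0 : x 0 < Q).

Definition hitting_time : \bar R :=
  ereal_inf [set t%:E | t in [set t : R | 0 < t /\ Q <= x t]].

Let near_x t e : 0 <= t -> 0 < e ->
  exists2 d : R, 0 < d & forall r, 0 <= r -> `|r - t| < d -> `|x r - x t| < e.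
Proof.
move=> t0 e0.
have := (subspace_continuousP _ _).1 xc t; rewrite /= in_itv/= t0 => /(_ isT).
move=> /cvgrPdist_lt /(_ e e0); rewrite near_withinE => -[d /= d0 hd].
exists d => // r r0 rt; rewrite distrC; apply: hd => /=; first by rewrite distrC.
by rewrite in_itv/= r0.
Qed.

(** A path below [Q] on [0, s] stays below [Q] a little longer by continuity, which makes the
    inequality strict. *)
Lemma lt_hitting_time s : 0 <= s ->
  (s%:E < hitting_time)%E <-> forall r, 0 <= r <= s -> x r < Q.
Proof.
move=> s0; split => [st r /andP[r0 rs]|xs].
  rewrite ltNge; apply/negP => Qr.
  have r_gt0 : 0 < r.
    by rewrite lt_def r0 andbT; apply/eqP => rE; move: x0; rewrite ltNge -rE Qr.
  have : (hitting_time <= r%:E)%E by apply: ereal_inf_lbound; exists r.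
  by move/(lt_le_trans st); rewrite lte_fin ltNge rs.
have q0 : 0 < Q - x s by rewrite subr_gt0; apply: xs; rewrite s0 lexx.
have [d d0 hd] := near_x s0 q0.
apply: (@lt_le_trans _ _ (s + d)%:E); first by rewrite lte_fin ltrDl.
apply: le_ereal_inf_tmp => _ [r [r0 Qr] <-]; rewrite lee_fin leNgt; apply/negP => rd.
have [rs|sr] := leP r s.
  by have := xs r; rewrite ltNge Qr rs (ltW r0) => /(_ isT).
have : `|x r - x s| < Q - x s.
  by apply: hd; [exact: ltW|rewrite ger0_norm ?subr_ge0 1?ltW// ltrBlDl].
by move/(le_lt_trans (ler_norm _)); rewrite ltrD2r ltNge Qr.
Qed.

Lemma hitting_time_gt0 : (0 < hitting_time)%E.
Proof.
by apply/(lt_hitting_time (lexx 0)) => r /andP[r0 r0']; rewrite (le_anti (introT andP (conj r0' r0))).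
Qed.

(** A path above [Q] at [s] would be above [Q] slightly earlier, at a time still before the hitting
    time. *)
Lemma le_hitting_time s : 0 <= s -> (s%:E <= hitting_time)%E -> x s <= Q.
Proof.
move=> s0 st; rewrite leNgt; apply/negP => Qs.
have q0 : 0 < x s - Q by rewrite subr_gt0.
have [d d0 hd] := near_x s0 q0.
have s_gt0 : 0 < s.
  by rewrite lt_def s0 andbT; apply/eqP => sE; move: x0; rewrite ltNge -sE ltW.
pose r := Num.max 0 (s - d / 2).
have r0 : 0 <= r by rewrite le_max lexx.
have rs : r < s by rewrite gt_max s_gt0/= ltrBlDl ltrDr divr_gt0.
have rd : `|r - s| < d.
  rewrite distrC gtr0_norm ?subr_gt0// ltrBlDl -ltrBlDr lt_max; apply/orP; right.
  by rewrite ltrD2l ltrN2 gtr_pMr// invf_lt1// ltr1n.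
have xr : x r < Q.
  apply: (lt_hitting_time r0).1; last by rewrite r0 lexx.
  by apply: lt_le_trans st; rewrite lte_fin.
have := hd r r0 rd; rewrite distrC => /(le_lt_trans (ler_norm _)).
by rewrite ltrD2l ltrN2 ltNge (ltW xr).
Qed.

Lemma hitting_time_value t : hitting_time = t%:E -> x t = Q.
Proof.
move=> tE; have t0 : 0 < t by rewrite -lte_fin -tE hitting_time_gt0.
have xQ : x t <= Q by apply: le_hitting_time; [exact: ltW|rewrite tE].
apply/eqP; rewrite eq_le xQ/= leNgt; apply/negP => xt.
have : (t%:E < hitting_time)%E.
  apply/(lt_hitting_time (ltW t0)) => r /andP[r0]; rewrite le_eqVlt => /orP[/eqP ->//|rt].
  apply: (lt_hitting_time r0).1; last by rewrite r0 lexx.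
  by rewrite tE lte_fin.
by rewrite tE ltxx.
Qed.

(* By compactness the maximum on [0, s] is below [Q] iff some [Q - 1/(p+1)]
   bounds the values on the grid points. *)
Lemma lt_hitting_time_grid s : 0 <= s ->
  (s%:E < hitting_time)%E <-> exists p : nat, forall m k : nat,
    k%:R / m.+1%:R <= s -> x (k%:R / m.+1%:R) <= Q - p.+1%:R^-1.
Proof.
move=> s0; rewrite (lt_hitting_time s0); split => [xs|[p xp] r /andP[r0 rs]].
  have xcs : {within `[0, s], continuous x}.
    have sub : (`[0, s] : set R) `<=` `[0, +oo[.
      by move=> u /=; rewrite !in_itv/= => /andP[->].
    by apply: (continuous_subspaceW sub); exact: xc.
  have [c cs xcmax] := EVT_max s0 xcs.
  have xcQ : 0 < Q - x c by rewrite subr_gt0 xs.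
  pose p := Num.trunc (Q - x c)^-1.
  exists p => m k ks; apply: (@le_trans _ _ (x c)).
    by apply: xcmax; rewrite in_itv/= ks divr_ge0.
  rewrite lerBrDr -lerBrDl -[leRHS]invrK lef_pV2 ?posrE ?invr_gt0//.
  exact/ltW/truncnS_gt.
apply: (@le_lt_trans _ _ (Q - p.+1%:R^-1)); last by rewrite ltrBlDr ltrDl invr_gt0.
have xg := @within_continuous_cvg _ x (fun m => grid m r) r xc r0
  (fun m => grid_ge0 m r) (grid_cvg r0).
rewrite -(cvg_lim (@Rhausdorff R) xg); apply: limr_le.
  by apply/cvg_ex; exists (x r).
by apply: nearW => m; apply: xp; apply: le_trans rs; exact: grid_le.
Qed.

End hitting_time.

Lemma within_continuous_sum (R : realType) (I : Type) (r : seq I) (A : set R)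
    (f : I -> R -> R) : (forall i, {within A, continuous (f i)}) ->
  {within A, continuous (fun t => \sum_(i <- r) f i t)}.
Proof.
move=> fc; elim: r => [|i r IH].
  have -> : (fun t => \sum_(i <- [::]) f i t) = fun=> 0 by apply/funext => t; rewrite big_nil.
  by move=> t; exact: cvg_cst.
have -> : (fun t => \sum_(j <- i :: r) f j t) = fun t => f i t + \sum_(j <- r) f j t.
  by apply/funext => t; rewrite big_cons.
by move=> t; apply: cvgD; [exact: fc|exact: IH].
Qed.

(** * The quantity policy as an integrable stopping time *)

Section quantity_policy.
Context {d : measure_display} {T : measurableType d} {R : realType}.
Variables (P : probability T R) (n : nat) (B : 'I_n -> R -> {RV P >-> R}).
Hypothesis B_brownian : forall i, standard_brownian_motion (B i).
Variables (Dm sg : 'I_n -> R).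
Local Notation N := (demand Dm sg B).

Lemma total_demandE t w : \sum_(i < n) N i t w =
  (\sum_(i < n) Dm i) * t + \sum_(i < n) sg i * B i t w.
Proof. by rewrite /demand big_split/= -mulr_suml. Qed.

Lemma total_demand_continuous w :
  {within `[0, +oo[, continuous (fun t : R => \sum_(i < n) N i t w)}.
Proof.
apply: within_continuous_sum => i.
have cD : {within `[0, +oo[, continuous (fun t : R => Dm i * t)}.
  by apply: continuous_subspaceT => u; apply: cvgM; [exact: cvg_cst|exact: cvg_id].
move=> t; apply: cvgD; first exact: cD.
by apply: cvgM; [exact: cvg_cst|exact: (bm_continuous (B_brownian i))].
Qed.

Lemma total_demand0 w : \sum_(i < n) N i 0 w = 0.
Proof.
rewrite total_demandE mulr0 add0r big1// => i _.
by rewrite (bm_start (B_brownian i)) mulr0.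
Qed.

Lemma total_rate_gt0 : (0 < n)%N -> (forall i, 0 < Dm i) -> 0 < \sum_(i < n) Dm i.
Proof.
case: n Dm => // m F _ F0.
by rewrite big_ord_recl ltr_pwDl// sumr_ge0// => i _; exact: ltW.
Qed.

Hypothesis n_gt0 : (0 < n)%N.
Hypothesis B_independent : independent_processes B.
Hypothesis Dm_gt0 : forall i, 0 < Dm i.
Let D := \sum_(i < n) Dm i.
Variable Q : R.
Hypothesis Q_gt0 : 0 < Q.

Let D_gt0 : 0 < D. Proof. exact: total_rate_gt0. Qed.

Let X (w : T) (t : R) : R := \sum_(i < n) N i t w.

Let XE w t : X w t = D * t + \sum_(i < n) sg i * B i t w.
Proof. exact: total_demandE. Qed.

Let X_continuous w : {within `[0, +oo[, continuous (X w)}.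
Proof. exact: total_demand_continuous. Qed.

Let X0 w : X w 0 < Q. Proof. by rewrite /X total_demand0. Qed.

Let tau w : \bar R := quantity_time N Q w.

Let tauE w : tau w = hitting_time (X w) Q. Proof. by []. Qed.

Lemma quantity_time_gt0 w : (0 < quantity_time N Q w)%E.
Proof. by rewrite -/(tau w) tauE hitting_time_gt0. Qed.

(** The grid criterion presents the event as a countable union of countable intersections of
    conditions on grid times up to [s]. *)
Lemma quantity_time_stopping : extended_stopping_time B (quantity_time N Q).
Proof.
split=> [w|s s0]; first by rewrite ltW// quantity_time_gt0.
pose lvl (p m k : nat) : set T := [set w | k%:R / m.+1%:R <= s ->
  X w (k%:R / m.+1%:R) <= Q - p.+1%:R^-1].
rewrite (_ : [set w | _] = \bigcup_p \bigcap_m \bigcap_k lvl p m k); last first.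
  apply/seteqP; split => w; rewrite /= -/(tau w) tauE.
    move/(lt_hitting_time_grid (@X_continuous w) (X0 w) s0) => [p hp].
    by exists p => // m _ k _; exact: hp.
  move=> [p _ hp]; apply/(lt_hitting_time_grid (@X_continuous w) (X0 w) s0).
  by exists p => m k; exact: hp.
apply: (@bigcupT_measurable _ (g_sigma_algebraType (history_gen B (past s)))) => p.
apply: (@bigcapT_measurable _ (g_sigma_algebraType (history_gen B (past s)))) => m.
apply: (@bigcapT_measurable _ (g_sigma_algebraType (history_gen B (past s)))) => k.
have [ks|ks] := leP (k%:R / m.+1%:R) s; last first.
  rewrite (_ : lvl _ _ _ = setT); first exact: measurableT.
  by apply/seteqP; split => w //= _; rewrite /lvl/= leNgt ks.
have aX : adapted B (past s) (X^~ (k%:R / m.+1%:R)).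
  apply: measurable_sum => i; rewrite /demand.
  apply: (@measurable_funD _ (g_sigma_algebraType (history_gen B (past s)))) => //.
  apply: (@measurable_funM _ (g_sigma_algebraType (history_gen B (past s)))) => //.
  by apply: adapted_path; rewrite /past/= in_itv/= ks divr_ge0.
have := adapted_preimage (C := `]-oo, (Q - p.+1%:R^-1)]%classic) aX (measurable_itv _).
congr (history _ _ _); apply/seteqP; split => w; rewrite /lvl/= in_itv/=.
  by move=> h _.
by apply.
Qed.

Let tr K := truncated_time tau K.

Let tau0 w : (0 <= tau w)%E. Proof. exact/ltW/quantity_time_gt0. Qed.

Let stopped_truncated_mean i K : 0 < K -> \int[P]_w B i (tr K w) w = 0 /\
  P.-integrable setT (EFin \o (fun w => B i (tr K w) w)).
Proof.
move=> K0; have st := truncated_stopping_time quantity_time_stopping (ltW K0).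
have le_tr w : tr K w <= K by apply: truncated_time_le => //; exact: ltW.
have gt_tr w : [set: T] w -> 0 < tr K w.
  by move=> _; rewrite lt_truncated_time ?(ltW K0)// K0 andbT quantity_time_gt0.
have hT : history B (past 0) setT by exact: historyT.
have E : (fun w => \1_[set: T] w * (B i (tr K w) w - B i 0 w)) = fun w => B i (tr K w) w.
  by apply/funext => w; rewrite indicT mul1r (bm_start (B_brownian i)) subr0.
have m0 := stopped_mean B_brownian B_independent (lexx 0) K0 st le_tr hT gt_tr i.
have s0 := stopped_square_integrable B_brownian B_independent (lexx 0) K0 st le_tr hT gt_tr i.
rewrite E in m0 s0; split => //; exact: square_integrable_integrable.
Qed.

Let tr_integrable K : 0 < K -> P.-integrable setT (EFin \o tr K).
Proof.
move=> K0; apply: (@le_integrable_real _ _ _ _ _ (fun=> K)).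
- exact: stopping_time_measurable (truncated_stopping_time quantity_time_stopping (ltW K0)).
- exact: integrable_cst_real.
- move=> w; rewrite ger0_norm; first by apply: truncated_time_le => //; exact: ltW.
  by apply: truncated_time_ge0 => //; exact: ltW.
Qed.

Let stopped_sum_mean K : 0 < K -> \int[P]_w (\sum_(i < n) sg i * B i (tr K w) w) = 0 /\
  P.-integrable setT (EFin \o (fun w => \sum_(i < n) sg i * B i (tr K w) w)).
Proof.
move=> K0.
have iB i : P.-integrable setT (EFin \o (fun w => sg i * B i (tr K w) w)).
  by apply: integrableZ_real; exact: (stopped_truncated_mean i K0).2.
have [i1 e1] := mean_sum (index_enum 'I_n) iB.
split => //; rewrite e1; apply: big1 => i _.
by rewrite RintegralZl ?(stopped_truncated_mean i K0).1 ?mulr0//;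
  exact: (stopped_truncated_mean i K0).2.
Qed.

(** Total demand at the truncated time is at most [Q], and its mean is [D] times the mean of that
    time because the Brownian part has mean 0. *)
Let tr_mean_le K : 0 < K -> \int[P]_w tr K w <= Q / D.
Proof.
move=> K0; rewrite ler_pdivlMr// mulrC -RintegralZl//; last exact: tr_integrable.
have [e1 i1] := stopped_sum_mean K0.
rewrite -[leLHS]addr0 -e1 -RintegralD//; last by apply: integrableZ_real; exact: tr_integrable.
rewrite -[leRHS](mean_cst P); apply: le_Rintegral => //.
- by apply: integrableD_real => //; apply: integrableZ_real; exact: tr_integrable.
- exact: integrable_cst_real.
- move=> w _; rewrite -XE; apply: (le_hitting_time (@X_continuous w) (X0 w)).
    by apply: truncated_time_ge0 => //; exact: ltW.
  by rewrite -tauE; apply: truncated_time_le_time => //; exact: ltW.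
Qed.

(** Monotone convergence from the bound Q / D, which is uniform in the truncation level;
    measurability also comes from the limit. *)
Lemma quantity_time_integrable : P.-integrable setT (quantity_time N Q).
Proof.
have um m : 0 < 1 + m%:R :> R by rewrite ltr_pwDl.
have mtr m : measurable_fun setT (EFin \o tr (1 + m%:R)).
  exact: measurable_int (tr_integrable (um m)).
have trc w : setT w -> (tr (1 + m%:R) w)%:E @[m --> \oo] --> tau w.
  by move=> _; exact: (truncated_time_cvg ler01 (tau0 w)).
have mtau : measurable_fun setT tau by exact: emeasurable_fun_cvg mtr trc.
apply/integrableP; split => //.
under eq_integral do rewrite gee0_abs//.
apply: (@le_lt_trans _ _ (Q / D)%:E); last exact: ltry.
have E w : quantity_time N Q w = limn (fun m => (tr (1 + m%:R) w)%:E).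
  by apply/esym/cvg_lim => //; exact: trc.
under eq_integral do rewrite E.
rewrite monotone_convergence//; last 2 first.
- by move=> m w _; rewrite lee_fin; apply: truncated_time_ge0 => //; exact: ltW.
- move=> w _ m k mk; rewrite lee_fin -lee_fin !truncated_timeE//; try exact: ltW.
  by rewrite le_min ge_min lexx/= ge_min lee_fin lerD2l ler_nat mk orbT.
apply: lime_le.
  apply: ereal_nondecreasing_is_cvgn => m k mk; apply: ge0_le_integral => //.
  - by move=> w _; rewrite lee_fin; apply: truncated_time_ge0 => //; exact: ltW.
  - exact: mtr.
  - exact: mtr.
  - move=> w _; rewrite !truncated_timeE//; try exact: ltW.
    by rewrite le_min ge_min lexx/= ge_min lee_fin lerD2l ler_nat mk orbT.
apply: nearW => m; rewrite -[leLHS]fineK; last first.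
  by apply: integrable_fin_num => //; exact: tr_integrable.
by rewrite lee_fin; exact: tr_mean_le.
Qed.

End quantity_policy.

(** * Moments of the quantity policy *)

Section almost_everywhere.
Context {d : measure_display} {T : measurableType d} {R : realType}.
Variable P : probability T R.
Implicit Types f g : T -> R.

Lemma Rintegral_ae_eq f g : measurable_fun setT f -> measurable_fun setT g ->
  {ae P, forall w, f w = g w} -> \int[P]_w f w = \int[P]_w g w.
Proof.
move=> mf mg fg; congr fine; apply: ae_eq_integral => //.
- exact/measurable_EFinP.
- exact/measurable_EFinP.
- by apply: filterS fg => w /= ->.
Qed.

Lemma square_integrable_ae_eq f g : measurable_fun setT f ->
  {ae P, forall w, f w = g w} -> square_integrable P g -> square_integrable P f.
Proof.
move=> mf fg [mg sg]; split => //.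
have m2 (h : T -> R) : measurable_fun setT h ->
    measurable_fun setT (fun w => (h w ^+ 2)%:E).
  by move=> mh; apply/measurable_EFinP; exact: measurable_funX.
apply/integrableP; split; first exact: m2.
move/integrableP : sg => [_]; apply: le_lt_trans.
rewrite le_eqVlt; apply/orP; left; apply/eqP; apply: ae_eq_integral => //.
- by apply: measurableT_comp => //; exact: m2.
- by apply: measurableT_comp => //; exact: m2.
- by apply: filterS fg => w /= ->.
Qed.

End almost_everywhere.

Section quantity_moments.
Context {d : measure_display} {T : measurableType d} {R : realType}.
Variables (P : probability T R) (n : nat) (B : 'I_n -> R -> {RV P >-> R}).
Hypothesis n_gt0 : (0 < n)%N.
Hypothesis B_brownian : forall i, standard_brownian_motion (B i).
Hypothesis B_independent : independent_processes B.
Variables (Dm sg : 'I_n -> R).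
Hypothesis Dm_gt0 : forall i, 0 < Dm i.
Local Notation N := (demand Dm sg B).
Let D := \sum_(i < n) Dm i.
Let sigma2 := \sum_(i < n) sg i ^+ 2.
Variable Q : R.
Hypothesis Q_gt0 : 0 < Q.

Let tau := quantity_time N Q.
Let rt w : R := fine (tau w).
Let st : extended_stopping_time B tau := quantity_time_stopping B_brownian Dm sg Q_gt0.
Let it : P.-integrable setT tau :=
  quantity_time_integrable B_brownian sg n_gt0 B_independent Dm_gt0 Q_gt0.
Let tau_gt0 w : (0 < tau w)%E := quantity_time_gt0 B_brownian Dm sg Q_gt0 w.

Let ift : P.-integrable setT (EFin \o rt) := stopping_time_fin_integrable st it.
Let mrt : measurable_fun setT rt := integrable_measurable ift.

Let sB i : square_integrable P (fun w => B i (rt w) w) :=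
  stopped_path_square_integrable B_brownian B_independent st it tau_gt0 i.

Let Y w := \sum_(i < n) sg i * B i (rt w) w.

Let sY : square_integrable P Y.
Proof. by apply: square_integrable_sum => i; exact: square_integrableZ. Qed.

Let level_ae : {ae P, forall w, D * rt w + Y w = Q}.
Proof.
apply: filterS (integrable_ae measurableT it) => w /(_ I) wfin.
have X0 : \sum_(i < n) N i 0 w < Q.
  by rewrite total_demand0.
have E : hitting_time (fun t => \sum_(i < n) N i t w) Q = (rt w)%:E.
  by rewrite /rt fineK.
rewrite -(hitting_time_value _ X0 E); last exact: total_demand_continuous.
by rewrite total_demandE.
Qed.

Let DY_measurable : measurable_fun setT (fun w => D * rt w + Y w).
Proof. by apply: measurable_funD; [exact: measurable_funM|exact: sY.1]. Qed.

Let stopped_sum_mean : \int[P]_w Y w = 0.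
Proof.
have iB i : P.-integrable setT (EFin \o (fun w => sg i * B i (rt w) w)).
  by apply: integrableZ_real; exact: square_integrable_integrable.
have [_ ->] := mean_sum (index_enum 'I_n) iB.
apply: big1 => i _; rewrite RintegralZl//; last exact: square_integrable_integrable.
by rewrite (stopped_path_mean B_brownian B_independent st it tau_gt0) mulr0.
Qed.

Lemma quantity_time_mean : \int[P]_w fine (quantity_time N Q w) = Q / D.
Proof.
have D0 : 0 < D := total_rate_gt0 n_gt0 Dm_gt0.
rewrite -/(rt _); apply: (mulfI (lt0r_neq0 D0)); rewrite mulrCA divff ?gt_eqF// mulr1.
rewrite -[LHS]addr0 -stopped_sum_mean -RintegralZl//.
rewrite -(RintegralD measurableT (integrableZ_real D ift) (square_integrable_integrable sY)).
by rewrite (Rintegral_ae_eq DY_measurable (@measurable_cst _ _ _ _ setT Q) level_ae) mean_cst.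
Qed.

(** Almost surely the time equals (Q - Y) / D, and [Y] is square-integrable by optional stopping. *)
Lemma quantity_time_square_integrable :
  square_integrable P (fun w => fine (quantity_time N Q w)).
Proof.
have D0 : 0 < D := total_rate_gt0 n_gt0 Dm_gt0.
apply: (@square_integrable_ae_eq _ _ _ _ _ (fun w => D^-1 * (Q - Y w))) => //.
  apply: filterS level_ae => w h.
  have -> : Q - Y w = D * rt w by apply/eqP; rewrite subr_eq h.
  by rewrite mulKf// gt_eqF.
apply: square_integrableZ; apply: square_integrableB => //.
exact: square_integrable_cst.
Qed.

Let stopped_sum_covariance i : \int[P]_w (Y w * B i (rt w) w) = sg i * (Q / D).
Proof.
have iB j : P.-integrable setT (EFin \o (fun w => sg j * (B j (rt w) w * B i (rt w) w))).
  by apply: integrableZ_real; exact: square_integrable_mul.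
have [_ e1] := mean_sum (index_enum 'I_n) iB.
transitivity (\int[P]_w (\sum_(j < n) sg j * (B j (rt w) w * B i (rt w) w))).
  by apply: eq_Rintegral => w _; rewrite /Y mulr_suml; apply: eq_bigr => j _; rewrite mulrA.
rewrite e1 (bigD1 i)//= big1 ?addr0 => [|j ji].
  rewrite RintegralZl//; last exact: square_integrable_mul.
  rewrite (stopped_path_covariance B_brownian B_independent st it tau_gt0).
  by rewrite eqxx mul1r quantity_time_mean.
rewrite RintegralZl//; last exact: square_integrable_mul.
rewrite (stopped_path_covariance B_brownian B_independent st it tau_gt0).
by rewrite (negbTE ji) mul0r mulr0.
Qed.

Let mean_level_mul (h : T -> R) : square_integrable P h ->
  D * \int[P]_w (rt w * h w) + \int[P]_w (Y w * h w) = Q * \int[P]_w h w.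
Proof.
move=> sh; have srt := quantity_time_square_integrable.
have i1 := square_integrable_mul srt sh; have i2 := square_integrable_mul sY sh.
have i3 := integrableZ_real D i1; have ih := square_integrable_integrable sh.
rewrite -(@RintegralZl _ _ _ P setT _ D measurableT i1).
rewrite -(@RintegralZl _ _ _ P setT _ Q measurableT ih).
rewrite -(RintegralD measurableT i3 i2); apply: Rintegral_ae_eq.
- exact: integrable_measurable (integrableD_real i3 i2).
- by apply: measurable_funM => //; exact: sh.1.
- by apply: filterS level_ae => w lvl; rewrite mulrA -mulrDl lvl.
Qed.

Lemma quantity_time_path_mean i :
  \int[P]_w (fine (quantity_time N Q w) * B i (fine (quantity_time N Q w)) w) =
  - sg i * Q / D ^+ 2.
Proof.
have D0 : 0 < D := total_rate_gt0 n_gt0 Dm_gt0; rewrite -/(tau _) -/(rt _).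
have := mean_level_mul (sB i); rewrite stopped_sum_covariance.
rewrite (stopped_path_mean B_brownian B_independent st it tau_gt0) mulr0.
move/eqP; rewrite addr_eq0 => /eqP h.
by apply: (mulfI (lt0r_neq0 D0)); rewrite h; field; rewrite gt_eqF.
Qed.

Lemma quantity_time_second_moment :
  \int[P]_w fine (quantity_time N Q w) ^+ 2 = Q ^+ 2 / D ^+ 2 + Q * sigma2 / D ^+ 3.
Proof.
have D0 : 0 < D := total_rate_gt0 n_gt0 Dm_gt0; rewrite -/(tau _) -/(rt _).
have := mean_level_mul quantity_time_square_integrable; rewrite quantity_time_mean.
have -> : \int[P]_w (Y w * fine (quantity_time N Q w)) = - sigma2 * Q / D ^+ 2.
  have srt := quantity_time_square_integrable.
  have iB j : P.-integrable setT (EFin \o (fun w => sg j * (rt w * B j (rt w) w))).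
    by apply: integrableZ_real; exact: square_integrable_mul.
  have [_ e1] := mean_sum (index_enum 'I_n) iB.
  transitivity (\int[P]_w (\sum_(j < n) sg j * (rt w * B j (rt w) w))).
    apply: eq_Rintegral => w _; rewrite /Y mulr_suml; apply: eq_bigr => j _.
    by rewrite -mulrA [_ * fine _]mulrC.
  rewrite e1; transitivity (\sum_(j < n) sg j ^+ 2 * (- Q / D ^+ 2)); last first.
    by rewrite -mulr_suml -/sigma2; ring.
  apply: eq_bigr => j _; rewrite RintegralZl//; last exact: square_integrable_mul.
  by rewrite quantity_time_path_mean; ring.
have -> : \int[P]_w (rt w * fine (quantity_time N Q w)) = \int[P]_w rt w ^+ 2.
  by apply: eq_Rintegral => w _; rewrite expr2.
move=> h; apply: (mulfI (lt0r_neq0 D0)).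
have -> : D * \int[P]_w rt w ^+ 2 = Q * (Q / D) - - sigma2 * Q / D ^+ 2.
  by rewrite -h; ring.
by field; rewrite gt_eqF.
Qed.

End quantity_moments.

(** * Costs *)

Section average_cost_of_stopping_time.
Context {d : measure_display} {T : measurableType d} {R : realType}.
Variables (P : probability T R) (n : nat) (B : 'I_n -> R -> {RV P >-> R}).
Hypothesis B_brownian : forall i, standard_brownian_motion (B i).
Hypothesis B_independent : independent_processes B.
Variables (Dm sg : 'I_n -> R).
Local Notation N := (demand Dm sg B).
Local Notation mu := (@lebesgue_measure R).

Lemma Rintegral_id (x : R) : 0 <= x ->
  mu.-integrable `[0, x] (EFin \o (fun u : R => u)) /\
  \int[mu]_(u in `[0, x]) u = x ^+ 2 / 2.
Proof.
move=> x0; split.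
  apply: continuous_compact_integrable; first exact: segment_compact.
  by apply: continuous_subspaceT => u; exact: cvg_id.
move: x0; rewrite le_eqVlt => /orP[/eqP <-|x0].
  by rewrite set_itv1 Rintegral_set1 expr0n mul0r.
pose F (u : R) := 2^-1 * u ^+ 2.
have dF (u : R) : is_derive u 1 F u.
  by apply: is_derive_eq; rewrite /GRing.scale/= mulr1; field.
have cF : continuous F.
  by move=> u; apply: differentiable_continuous; apply/derivable1_diffP; have [] := dF u.
rewrite /Rintegral (@continuous_FTC2 _ _ F)//.
- by rewrite /F /= expr0n mulr0 subr0 mulrC.
- by apply: continuous_subspaceT => u; exact: cvg_id.
- split => [u _||]; first by have [] := dF u.
  + by apply: cvg_at_right_filter; exact: cF.
  + by apply: cvg_at_left_filter; exact: cF.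
- by move=> u _; rewrite derive1E; have [_ ->] := dF u.
Qed.

Lemma waiting_time_integral i w (om x : R) : 0 <= x ->
  \int[mu]_(u in `[0, x]) (om * N i u w) =
  om * (Dm i * x ^+ 2 / 2 + sg i * \int[mu]_(u in `[0, x]) B i u w).
Proof.
move=> x0; have [iid eid] := Rintegral_id x0.
have iB : mu.-integrable `[0, x] (EFin \o (fun u => B i u w)).
  apply: continuous_compact_integrable; first exact: segment_compact.
  have sub : (`[0, x] : set R) `<=` `[0, +oo[ by move=> u /=; rewrite !in_itv/= => /andP[->].
  by apply: (continuous_subspaceW sub); exact: (bm_continuous (B_brownian i)).
have mI : measurable (`[0, x]%classic : set (measurableTypeR R)) by exact: measurable_itv.
have i1 : mu.-integrable `[0, x] (EFin \o (fun u : R => Dm i * u)).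
  exact: (integrableZl mI (Dm i) iid).
have i2 : mu.-integrable `[0, x] (EFin \o (fun u : R => sg i * B i u w)).
  exact: (integrableZl mI (sg i) iB).
rewrite RintegralZl//; last exact: (integrableD mI i1 i2).
congr (_ * _); rewrite /demand (RintegralD mI i1 i2).
by rewrite (RintegralZl _ mI iid) (RintegralZl _ mI iB) eid mulrA.
Qed.

Variable tau : T -> \bar R.
Hypothesis tau_stop : extended_stopping_time B tau.
Hypothesis tau_int : P.-integrable setT tau.
Hypothesis tau_gt0 : forall w, (0 < tau w)%E.
Hypothesis tau_sqr : square_integrable P (fun w => fine (tau w)).

(** Only three kinds of moments of the cycle enter: its mean, its second moment and its mixed
    moments with the stopped motions. Both policies are instances. *)
Lemma average_cost_stopping_time (AD : R) (c omega : 'I_n -> R) :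
  0 < \int[P]_w fine (tau w) ->
  average_cost P N AD c omega tau =
  ((AD + \sum_(i < n) c i * Dm i * \int[P]_w fine (tau w) +
    \sum_(i < n) omega i * (Dm i * (\int[P]_w fine (tau w) ^+ 2) / 2 +
      sg i * \int[P]_w (fine (tau w) * B i (fine (tau w)) w))) /
   \int[P]_w fine (tau w))%:E.
Proof.
move=> m0; have tau0 w : 0 <= fine (tau w) by rewrite fine_ge0// ltW.
have ift := stopping_time_fin_integrable tau_stop tau_int.
have sB := stopped_path_square_integrable B_brownian B_independent tau_stop tau_int tau_gt0.
rewrite /average_cost (mean_stopping_time tau_stop tau_int) inver gt_eqF//.
have iN i : P.-integrable setT (EFin \o (fun w => c i * N i (fine (tau w)) w)).
  apply: integrableZ_real; apply: integrableD_real.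
    exact: integrableZ_real.
  by apply: integrableZ_real; exact: square_integrable_integrable.
have iA i := stopped_area B_brownian B_independent tau_stop tau_int tau_gt0 tau_sqr i.
have iI i : P.-integrable setT (EFin \o (fun w =>
    \int[mu]_(u in `[0, fine (tau w)]) (omega i * N i u w))).
  under eq_fun do rewrite waiting_time_integral//.
  apply: integrableZ_real; apply: integrableD_real.
    have := integrableZ_real (Dm i / 2) tau_sqr.2.
    by apply: eq_integrable => // w _ /=; rewrite mulrAC.
  by apply: integrableZ_real; exact: (iA i).1.
have [sN eN] := mean_sum (index_enum 'I_n) iN.
have [sI eI] := mean_sum (index_enum 'I_n) iI.
have E (f : T -> R) : P.-integrable setT (EFin \o f) -> expectation P f = (\int[P]_w f w)%:E.
  by move=> fi; rewrite unlock /Rintegral fineK// integrable_fin_num.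
rewrite (E _ sN) (E _ sI) eN eI -!EFinD -EFinM; congr (EFin ((_ + _ + _) / _)).
  apply: eq_bigr => i _; rewrite RintegralZl//; last first.
    apply: integrableD_real; first exact: integrableZ_real.
    by apply: integrableZ_real; exact: square_integrable_integrable.
  rewrite -mulrA; congr (_ * _); rewrite /demand RintegralD//; last 2 first.
  - exact: integrableZ_real.
  - by apply: integrableZ_real; exact: square_integrable_integrable.
  rewrite RintegralZl// RintegralZl//; last exact: square_integrable_integrable.
  by rewrite (stopped_path_mean B_brownian B_independent tau_stop tau_int tau_gt0) mulr0 addr0.
apply: eq_bigr => i _; under eq_Rintegral do rewrite waiting_time_integral//.
have j1 : P.-integrable setT (EFin \o (fun w => Dm i * fine (tau w) ^+ 2 / 2)).
  have := integrableZ_real (Dm i / 2) tau_sqr.2.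
  by apply: eq_integrable => // w _ /=; rewrite mulrAC.
have j2 := integrableZ_real (sg i) (iA i).1.
rewrite RintegralZl//; last exact: integrableD_real.
rewrite (RintegralD measurableT j1 j2) RintegralZl//; last exact: (iA i).1.
rewrite (iA i).2; congr (_ * (_ + _)).
transitivity (\int[P]_w (Dm i / 2 * fine (tau w) ^+ 2)).
  by apply: eq_Rintegral => w _; rewrite mulrAC.
by rewrite RintegralZl//; [rewrite mulrAC|exact: tau_sqr.2].
Qed.

End average_cost_of_stopping_time.

(** * Cost formulas and comparison of the two policies *)

Section optimal_policies.
Context {d : measure_display} {T : measurableType d} {R : realType}.
Variables (P : probability T R) (n : nat) (B : 'I_n -> R -> {RV P >-> R}).
Hypothesis B_brownian : forall i, standard_brownian_motion (B i).
Hypothesis B_independent : independent_processes B.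
Variables (Dm sg : 'I_n -> R) (AD : R) (c omega : 'I_n -> R).
Local Notation N := (demand Dm sg B).
Let D := \sum_(i < n) Dm i.
Let sigma2 := \sum_(i < n) sg i ^+ 2.
Let W := \sum_(i < n) omega i * Dm i.

Definition time_cost (t : R) : R :=
  AD / t + W / 2 * t + \sum_(i < n) c i * Dm i.

Lemma average_cost_time t : 0 < t ->
  average_cost P N AD c omega (time_cycle t) = (time_cost t)%:E.
Proof.
move=> t0.
have st : extended_stopping_time B (time_cycle t).
  split=> [w|s s0]; first by rewrite lee_fin ltW.
  have [ts|st] := leP t s.
    rewrite (_ : [set w | _] = set0).
      exact: (@measurable0 _ (g_sigma_algebraType (history_gen B (past s)))).
    by apply/seteqP; split => w //=; rewrite lte_fin ltNge ts.
  rewrite (_ : [set w | _] = setT); first exact: historyT.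
  by apply/seteqP; split => w //= _; rewrite lte_fin.
have it : P.-integrable setT (time_cycle t) by exact: (integrable_cst_real P t).
have t_gt0 (w : T) : (0 < time_cycle t w)%E by rewrite lte_fin.
have sqt : square_integrable P (fun w => fine (time_cycle t w)).
  exact: square_integrable_cst.
have mE : \int[P]_w fine (time_cycle t w) = t by exact: mean_cst.
rewrite (average_cost_stopping_time B_brownian B_independent Dm sg st it t_gt0 sqt) ?mE//.
have -> : \int[P]_w fine (time_cycle t w) ^+ 2 = t ^+ 2 by exact: (mean_cst P (t ^+ 2)).
have E i : \int[P]_w (fine (time_cycle t w) * B i (fine (time_cycle t w)) w) = 0.
  rewrite RintegralZl//.
    by rewrite (stopped_path_mean B_brownian B_independent st it t_gt0) mulr0.
  apply: square_integrable_integrable.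
  exact: (stopped_path_square_integrable B_brownian B_independent st it t_gt0).
congr EFin; rewrite /time_cost.
have -> : \sum_(i < n) omega i * (Dm i * t ^+ 2 / 2 + sg i *
    \int[P]_w (fine (time_cycle t w) * B i (fine (time_cycle t w)) w)) = W * (t ^+ 2 / 2).
  by rewrite /W mulr_suml; apply: eq_bigr => i _; rewrite E mulr0 addr0 !mulrA.
rewrite -mulr_suml; field.
by rewrite gt_eqF.
Qed.

Hypothesis n_gt0 : (0 < n)%N.
Hypothesis Dm_gt0 : forall i, 0 < Dm i.

(** After division by the mean Q / D, the variance of the cycle adds omega_i D_i sigma^2 / (2 D^2)
    and its covariance with [B_i] subtracts omega_i sigma_i^2 / D. Together they form the
    correction, which is free of [Q]. *)
Lemma average_cost_quantity Q : 0 < Q ->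
  average_cost P N AD c omega (quantity_time N Q) =
  (time_cost (Q / D) -
   (\sum_(i < n) omega i * (2 * D * sg i ^+ 2 - Dm i * sigma2)) / (2 * D ^+ 2))%:E.
Proof.
move=> Q0; have D0 : 0 < D := total_rate_gt0 n_gt0 Dm_gt0.
have st := quantity_time_stopping B_brownian Dm sg Q0.
have it := quantity_time_integrable B_brownian sg n_gt0 B_independent Dm_gt0 Q0.
have t_gt0 := quantity_time_gt0 B_brownian Dm sg Q0.
have sqt := quantity_time_square_integrable n_gt0 B_brownian B_independent sg Dm_gt0 Q0.
have mE := quantity_time_mean n_gt0 B_brownian B_independent sg Dm_gt0 Q0.
rewrite (average_cost_stopping_time B_brownian B_independent Dm sg st it t_gt0 sqt);
  last by rewrite mE divr_gt0.
rewrite mE (quantity_time_second_moment n_gt0 B_brownian B_independent sg Dm_gt0 Q0).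
have E i := quantity_time_path_mean n_gt0 B_brownian B_independent sg Dm_gt0 Q0 i.
rewrite -/D -/sigma2; congr EFin; rewrite /time_cost.
set S := \sum_(i < n) omega i * (2 * D * _ - _).
have -> : \sum_(i < n) omega i * (Dm i * (Q ^+ 2 / D ^+ 2 + Q * sigma2 / D ^+ 3) / 2 + sg i *
    \int[P]_w (fine (quantity_time N Q w) * B i (fine (quantity_time N Q w)) w)) =
    W * (Q ^+ 2 / (2 * D ^+ 2)) - S * (Q / (2 * D ^+ 3)).
  rewrite /W /S !mulr_suml -sumrB; apply: eq_bigr => i _; rewrite E -/D; field.
  by rewrite gt_eqF.
rewrite -mulr_suml; field.
by rewrite !gt_eqF.
Qed.

End optimal_policies.

(** Eliminating [AD] by the equation for [t0] turns the difference of the costs into W (t - t0)^2 /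
    (2 t). *)
Lemma time_cost_min (R : realType) (n : nat) (Dm c omega : 'I_n -> R) (AD t0 t : R) :
  0 < \sum_(i < n) omega i * Dm i -> 0 < t0 -> 0 < t ->
  (\sum_(i < n) omega i * Dm i) * t0 ^+ 2 = 2 * AD ->
  time_cost Dm AD c omega t0 <= time_cost Dm AD c omega t.
Proof.
rewrite /time_cost; set W := \sum_(i < n) omega i * _ => W0 t00 t_0 WE.
rewrite lerD2r -subr_ge0.
have -> : AD / t + W / 2 * t - (AD / t0 + W / 2 * t0) = W / 2 * (t - t0) ^+ 2 / t.
  have -> : AD = W * t0 ^+ 2 / 2 by rewrite WE mulrC mulKf.
  by field; rewrite !gt_eqF.
apply: divr_ge0 (ltW t_0); apply: mulr_ge0 (sqr_ge0 _).
by apply: divr_ge0 => //; exact: ltW.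
Qed.

Theorem theorem7 (R : realType) (d : measure_display) (T : measurableType d)
    (P : probability T R) (n : nat) (n_gt0 : (0 < n)%N)
    (B : 'I_n -> R -> {RV P >-> R})
    (B_brownian : forall i, standard_brownian_motion (B i))
    (B_independent : independent_processes B)
    (Dm sg : 'I_n -> R)
    (Dm_gt0 : forall i, 0 < Dm i) (sg_gt0 : forall i, 0 < sg i)
    (AD : R) (AD_gt0 : 0 < AD)
    (c omega : 'I_n -> R) (omega_gt0 : forall i, 0 < omega i) :
  let N := demand Dm sg B in
  let D := \sum_(i < n) Dm i in
  let sigma2 := \sum_(i < n) sg i ^+ 2 in
  let AC := average_cost P N AD c omega in
  let ACQ := fun Q : R => AC (quantity_time N Q) in
  let ACT := fun t : R => AC (time_cycle t) in
  let S := \sum_(i < n) omega i * (2 * D * sg i ^+ 2 - Dm i * sigma2) in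
  (0 < S -> exists Q t : R,
     [/\ optimal_parameter ACQ Q, optimal_parameter ACT t &
         (ACQ Q < ACT t)%E]) /\
  (S < 0 -> exists Q t : R,
     [/\ optimal_parameter ACQ Q, optimal_parameter ACT t &
         (ACT t < ACQ Q)%E]).
Proof.
move=> N D sigma2 AC ACQ ACT S.
have D0 : 0 < D := total_rate_gt0 n_gt0 Dm_gt0.
pose W := \sum_(i < n) omega i * Dm i.
have W0 : 0 < W by apply: total_rate_gt0 => // i; exact: mulr_gt0.
pose t0 := Num.sqrt (2 * AD / W).
have t00 : 0 < t0 by rewrite sqrtr_gt0 divr_gt0// mulr_gt0.
have t0E : W * t0 ^+ 2 = 2 * AD.
  by rewrite sqr_sqrtr; [field; rewrite gt_eqF|rewrite ltW// divr_gt0// mulr_gt0].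
have tmin t : 0 < t -> time_cost Dm AD c omega t0 <= time_cost Dm AD c omega t.
  by move=> t_0; exact: time_cost_min.
have QE Q : 0 < Q -> ACQ Q = (time_cost Dm AD c omega (Q / D) - S / (2 * D ^+ 2))%:E.
  by move=> Q0; exact: average_cost_quantity.
have TE t : 0 < t -> ACT t = (time_cost Dm AD c omega t)%:E.
  by move=> t_0; exact: average_cost_time.
have Q00 : 0 < t0 * D by exact: mulr_gt0.
have optT : optimal_parameter ACT t0.
  by split => // t t_0; rewrite !TE// lee_fin tmin.
have optQ : optimal_parameter ACQ (t0 * D).
  split => // Q Q0; rewrite !QE// lee_fin lerD2r mulfK ?gt_eqF//.
  by rewrite tmin// divr_gt0.
have DD : 0 < 2 * D ^+ 2 by rewrite mulr_gt0// exprn_gt0.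
split=> S0; exists (t0 * D), t0; split => //; rewrite QE// TE// lte_fin mulfK ?gt_eqF//.
  by rewrite gtrDl oppr_lt0 divr_gt0.
by rewrite ltrDl oppr_gt0 pmulr_llt0// invr_gt0.
Qed.
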